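(* Let $s>3/2$ and $\kappa\in\mathbb{R}$. Let $v\in C([0,+\infty),H^s(\mathbb{S}))\cap C^1([0,+\infty),H^{s-1}(\mathbb{S}))$ be a global (real-valued) solution of the periodic Degasperis-Procesi equation with dispersion $$v_t+vv_x+\partial_x p*\Bigl(\tfrac32 v^2+3\kappa v\Bigr)=0,\qquad t>0,\ x\in\mathbb{S}.$$ If there exists a point $(t_0,x_0)\in[0,+\infty)\times\mathbb{S}$ such that $v(t_0,x_0)=-\kappa$, then $v(t,x)=-\kappa$ for all $(t,x)\in[0,+\infty)\times\mathbb{S}$.
   Context: $\mathbb{S}=\mathbb{R}/\mathbb{Z}$ is the circle of length $1$; functions on $\mathbb{S}$ are identified with $1$-periodic functions on $\mathbb{R}$, and $H^s(\mathbb{S})$ is the usual $L^2$-based Sobolev space (real-valued functions). For $s>3/2$ elements of $H^s(\mathbb{S})$ are identified with their $C^1$ representatives, so pointwise values make sense. The kernel $p$ is the kernel of $(1-\partial_x^2)^{-1}$ on $\mathbb{S}$, i.e. the continuous $1$-periodic function $$p(x)=\frac{\cosh(x-[x]-1/2)}{2\sinh(1/2)},$$ where $[x]$ is the integer part of $x$, and $*$ denotes convolution on $\mathbb{S}$ in the $x$ variable. The real number $\kappa$ is the dispersion parameter. A solution is global if it exists in the stated class on all of $[0,+\infty)$. For $\kappa=0$ it is known that for every $u_0\in H^s(\mathbb{S})$, $s>3/2$, there exist $T>0$ and a unique solution in $C([0,T),H^s(\mathbb{S}))\cap C^1([0,T),H^{s-1}(\mathbb{S}))$ with initial datum $u_0$.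 *)

(* Defs.v *)
From Stdlib Require Import Reals ZArith.
From Coquelicot Require Import Coquelicot.
Open Scope R_scope.

(* Functions on the circle R/Z are 1-periodic functions on R. *)
Definition periodic1 (f : R -> R) : Prop := forall x, f (x + 1) = f x.

(* k-th Fourier coefficient: the integral over [0,1] of f(x) exp(-2 i pi k x). *)
Definition fourier (f : R -> R) (k : Z) : C :=
  (RInt (fun x => f x * cos (2 * PI * IZR k * x)) 0 1,
   - RInt (fun x => f x * sin (2 * PI * IZR k * x)) 0 1).

(* Folds a family indexed by Z into a sequence with the same sum; it is used
   for nonnegative families only, where the order of summation is irrelevant. *)
Definition foldZ (c : Z -> R) (n : nat) : R :=
  match n with
  | O => c 0%Z
  | S _ => c (Z.of_nat n) + c (- Z.of_nat n)%Z
  end.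

Definition Hs_term (s : R) (f : R -> R) (k : Z) : R :=
  Rpower (1 + (2 * PI * IZR k) ^ 2) s * Cmod (fourier f k) ^ 2.

(* For s > 1/2 every class in H^s(R/Z) has exactly one continuous
   representative, and Hs s is the space of these representatives.  For
   s <= 1/2 this would only be the subspace of continuous elements. *)
Definition Hs (s : R) (f : R -> R) : Prop :=
  periodic1 f /\ (forall x, continuous f x) /\ ex_series (foldZ (Hs_term s f)).

Definition Hs_norm (s : R) (f : R -> R) : R :=
  sqrt (Series (foldZ (Hs_term s f))).

(* v in C([0,+oo), H^s); the values of v at negative times are irrelevant. *)
Definition C0_Hs (s : R) (v : R -> R -> R) : Prop :=
  forall t, 0 <= t ->
    Hs s (v t) /\
    filterlim (fun t' => Hs_norm s (fun x => v t' x - v t x))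
      (within (fun t' => 0 <= t') (locally t)) (locally 0).

(* v in C^1([0,+oo), H^s) with time derivative vt (one-sided at t = 0). *)
Definition C1_Hs (s : R) (v vt : R -> R -> R) : Prop :=
  C0_Hs s v /\ C0_Hs s vt /\
  forall t, 0 <= t ->
    filterlim
      (fun t' => Hs_norm s (fun x => (v t' x - v t x) / (t' - t) - vt t x))
      (within (fun t' => 0 <= t' /\ t' <> t) (locally t)) (locally 0).

(* Int_part is the floor function. *)
Definition p (x : R) : R :=
  cosh (x - IZR (Int_part x) - 1 / 2) / (2 * sinh (1 / 2)).

Definition conv (f g : R -> R) (x : R) : R :=
  RInt (fun y => f (x - y) * g y) 0 1.

(* The space derivatives are classical: for s > 3/2 each v t is C^1, and p * g
   is C^1 for continuous periodic g. *)
Definition DP_global_solution (s kappa : R) (v : R -> R -> R) : Prop :=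
  C0_Hs s v /\
  exists vt : R -> R -> R,
    C1_Hs (s - 1) v vt /\
    forall t x, 0 < t ->
      vt t x + v t x * Derive (v t) x
      + Derive (conv p (fun y => 3 / 2 * v t y ^ 2 + 3 * kappa * v t y)) x = 0.

(* Main.v *)
Require Import Defs.
From Stdlib Require Import Reals.
From Stdlib Require Import Lra Lia ZArith FunctionalExtensionality Classical.
From Coquelicot Require Import Coquelicot.
Open Scope R_scope.

(* Put u = v + kappa.  Along a characteristic q' = u(t,q) - kappa the functions
   a = u(t,q) and g = u_x(t,q) satisfy a' = -Q and g' = -g^2 + (3/2) a^2 - P, where
   P = p * (3/2) u^2 and Q = d/dx P.  On the circle cosh z +- (3/2) sinh z > 0 for
   |z| <= 1/2, hence P +- (3/2) Q >= 0, strictly if u(t) is not identically zero.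
   With c = +-3/2, A = g + c a and B = g - c a this gives A' + A B <= -(P + c Q), so
   A exp(int B) is nonincreasing.  Since u(t0) is periodic, if it vanishes somewhere
   it has a zero with u_x <= 0; starting q there gives |a| <= (2/3) |g|, g < 0 at all
   later times, hence g' <= -g^2/3 and g blows up in finite time, unless u(t0) = 0
   identically.  In that case the conserved mean of u is 0, so u(t) has a zero for
   every t, and the same argument started at time t shows that u(t) = 0. *)

(** * Continuity and integrals of real functions *)

(** Where the constants come from: (3/2) v^2 + 3 kappa v = (3/2) u^2 - (3/2) kappa^2 and p * 1 is
    constant, so the shift by kappa clears the source of dispersion and leaves it only in the speed
    u - kappa. In A' + A B the coefficient of a^2 is 3/2 - c^2, and the cone |c a| <= |g| turns the
    equation for g into g' <= -(1 - 3/(2 c^2)) g^2; both ask for c^2 > 3/2. Positivity of cosh z + c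
    sinh z for |z| <= 1/2 asks for |c| < coth (1/2), about 2.16. The choice |c| = 3/2 lies in this
    window and gives the rate 1/3. The obstacle is regularity: for s > 3/2 the function u is only
    C^1 in x, so the equation for g does not follow by differentiating the PDE in x. It is proved
    for difference quotients along q, with error bounds independent of the step h, and then h tends
    to 0. The conserved mean works in both time directions, which covers times before t0. The
    embeddings of H^s into C^0 and C^1 are derived from the Fourier coefficients, starting from
    their uniqueness. *)

Lemma cont_mult (f g : R -> R) x : continuous f x -> continuous g x -> continuous (fun y => f y * g y) x.
Proof. intros; apply (continuous_mult f g); assumption. Qed.

Lemma cont_plus (f g : R -> R) x : continuous f x -> continuous g x -> continuous (fun y => f y + g y) x.
Proof. intros; apply (continuous_plus f g); assumption. Qed.

Lemma cont_minus (f g : R -> R) x : continuous f x -> continuous g x -> continuous (fun y => f y - g y) x.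
Proof. intros; apply (continuous_minus f g); assumption. Qed.

Lemma cont_opp (f : R -> R) x : continuous f x -> continuous (fun y => - f y) x.
Proof. intros; apply (continuous_opp f); assumption. Qed.

Lemma cont_pow (f : R -> R) n x : continuous f x -> continuous (fun y => f y ^ n) x.
Proof. intros; induction n; simpl; [apply continuous_const | apply cont_mult; assumption]. Qed.

Lemma cont_cos (f : R -> R) x : continuous f x -> continuous (fun y => cos (f y)) x.
Proof. intros; apply (continuous_comp f cos); [assumption | apply continuous_cos]. Qed.

Lemma cont_comp (f g : R -> R) x : continuous f x -> continuous g (f x) -> continuous (fun y => g (f y)) x.
Proof. intros; apply (continuous_comp f g); assumption. Qed.

Lemma cont_eps (f : R -> R) x : continuous f x <-> forall eps, 0 < eps -> exists d, 0 < d /\ forall y, Rabs (y - x) < d -> Rabs (f y - f x) < eps.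
Proof.
  split.
  - intros H eps He.
    destruct (proj1 (filterlim_locally f (f x)) H (mkposreal eps He)) as [d Hd].
    exists d. split; [apply cond_pos|]. intros y Hy. apply Hd. exact Hy.
  - intros H. apply filterlim_locally. intros eps. destruct (H eps (cond_pos eps)) as [d [Hd Hf]].
    exists (mkposreal d Hd). intros y Hy. apply Hf. exact Hy.
Qed.

Lemma ex_RInt_cont (f : R -> R) a b : (forall x, continuous f x) -> ex_RInt f a b.
Proof. intros H. apply (ex_RInt_continuous f). intros; apply H. Qed.

Lemma RInt_correct_R (f : R -> R) a b : ex_RInt f a b -> is_RInt f a b (RInt f a b).
Proof. exact (@RInt_correct R_CompleteNormedModule f a b). Qed.

Lemma RInt_Chasles_R (f : R -> R) a b c : (forall x, continuous f x) -> RInt f a b + RInt f b c = RInt f a c.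
Proof. intros H. apply (@RInt_Chasles R_CompleteNormedModule f); now apply ex_RInt_cont. Qed.

Lemma RInt_lin (f g : R -> R) a b l m : ex_RInt f a b -> ex_RInt g a b ->
  RInt (fun x => l * f x + m * g x) a b = l * RInt f a b + m * RInt g a b.
Proof.
  intros Hf Hg. apply is_RInt_unique.
  apply (is_RInt_plus (fun x => l * f x) (fun x => m * g x)).
  - apply (is_RInt_scal f _ _ l). now apply RInt_correct_R.
  - apply (is_RInt_scal g _ _ m). now apply RInt_correct_R.
Qed.

Lemma RInt_mulc (f : R -> R) a b l : ex_RInt f a b ->
  RInt (fun x => l * f x) a b = l * RInt f a b.
Proof. intros. apply is_RInt_unique. apply (is_RInt_scal f _ _ l). now apply RInt_correct_R. Qed.

(** The cases [Rmult ?c], [Rplus ?c] and [Rminus ?c] catch functions that unification has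
    eta-reduced. *)
Ltac cont := repeat (match goal with
  | H : forall x, continuous ?f x |- continuous ?f _ => apply H
  | H : forall x, continuous (?f _) x |- continuous (?f _) _ => apply H
  | H : forall t x, continuous (?f t) x |- continuous (?f _) _ => apply H
  | |- continuous (fun _ => ?c) _ => apply continuous_const
  | |- continuous (Rmult ?c) _ => apply (cont_mult (fun _ => c) (fun x => x))
  | |- continuous (Rplus ?c) _ => apply (cont_plus (fun _ => c) (fun x => x))
  | |- continuous (Rminus ?c) _ => apply (cont_minus (fun _ => c) (fun x => x))
  | |- continuous (fun x => x) _ => apply continuous_id
  | |- continuous (fun y => _ * _) _ => apply cont_mult
  | |- continuous (fun y => _ + _) _ => apply cont_plus
  | |- continuous (fun y => _ - _) _ => apply cont_minus
  | |- continuous (fun y => - _) _ => apply cont_opp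
  | |- continuous (fun y => cos _) _ => apply cont_cos
  | |- continuous (fun y => _ ^ _) _ => apply cont_pow
  | H : forall x, continuous ?f x |- continuous (fun y => ?f (@?g y)) _ => apply (cont_comp g f); [|apply H]
  end).

Lemma RInt_pos_point (h : R -> R) a b c : a < b -> (forall x, continuous h x) -> (forall x, a <= x <= b -> 0 <= h x) ->
  a <= c <= b -> 0 < h c -> 0 < RInt h a b.
Proof.
  intros Hab Hc Hn Hcab Hpos.
  destruct (proj1 (cont_eps h c) (Hc c) (h c / 2)) as [d [Hd Hh]]; [lra|].
  (* The point [c] may be an endpoint, so the neighbourhood on which [h] exceeds [h c / 2] is
     clipped to [a, b]. *)
  set (l := Rmax a (c - d / 2)). set (r := Rmin b (c + d / 2)).
  assert (a <= l /\ l < r /\ r <= b /\ c - d/2 <= l /\ r <= c + d/2) as (H1 & H2 & H3 & H4 & H5).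
  { unfold l, r, Rmax, Rmin. destruct (Rle_dec a (c - d/2)), (Rle_dec b (c+d/2)); lra. }
  assert (E := fun u w => ex_RInt_cont h u w Hc).
  rewrite <- (RInt_Chasles_R h a l b), <- (RInt_Chasles_R h l r b); auto.
  assert (0 <= RInt h a l) by (apply RInt_ge_0; auto; intros; apply Hn; lra).
  assert (0 <= RInt h r b) by (apply RInt_ge_0; auto; intros; apply Hn; lra).
  assert (0 < RInt h l r); [|lra].
  apply RInt_gt_0; auto. intros x Hx.
  specialize (Hh x). assert (Rabs (x - c) < d) by (apply Rabs_def1; lra).
  apply Hh in H6. apply Rabs_def2 in H6. lra.
Qed.

(** After [RInt_ext] and similar lemmas the equation lives in the carrier of an algebraic structure;
    [ring] and [field] need it over [R]. *)
Ltac toR := match goal with |- @eq _ ?a ?b => change (@eq R a b) end.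

Lemma continuous_bounded_itv (f : R -> R) a b : (forall x, continuous f x) -> exists M, 0 < M /\ forall x, a <= x <= b -> Rabs (f x) <= M.
Proof.
  intros Hf. destruct (Rle_dec a b) as [Hab | Hab].
  2: { exists 1. split; [lra|]. intros; lra. }
  destruct (continuity_ab_maj (fun x => Rabs (f x)) a b Hab) as [c [Hc _]].
  - intros c _. apply continuity_pt_filterlim. apply (cont_comp f Rabs); [apply Hf | apply continuous_Rabs].
  - exists (Rabs (f c) + 1). split; [pose proof (Rabs_pos (f c)); lra|]. intros x Hx. specialize (Hc x Hx). lra.
Qed.

Lemma periodic1_Z (f : R -> R) : periodic1 f -> forall (k : Z) x, f (x + IZR k) = f x.
Proof.
  intros Hf.
  assert (forall n : nat, forall x, f (x + INR n) = f x) as Hn.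
  { induction n as [|n IH]; intros x; [simpl; now rewrite Rplus_0_r|].
    rewrite S_INR, <- Rplus_assoc, Hf. apply IH. }
  intros k x. destruct (Z_le_gt_dec 0 k) as [Hk | Hk].
  - rewrite <- (Z2Nat.id k), <- INR_IZR_INZ by lia. apply Hn.
  - rewrite <- (Hn (Z.to_nat (- k)) (x + _)). f_equal. rewrite INR_IZR_INZ, Z2Nat.id, opp_IZR by lia. ring.
Qed.

Lemma unit_reduction (x : R) : exists k y, x = y + IZR k /\ 0 <= y < 1.
Proof.
  exists (Int_part x), (x - IZR (Int_part x)). split; [ring|].
  pose proof (base_Int_part x). lra.
Qed.

Lemma periodic1_bounded (f : R -> R) : periodic1 f -> (forall x, continuous f x) -> exists M, 0 < M /\ forall x, Rabs (f x) <= M.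
Proof.
  intros Hp Hc. destruct (continuous_bounded_itv f 0 1 Hc) as [M [H0 HM]].
  exists M. split; [exact H0|]. intros x. destruct (unit_reduction x) as [k [y [-> Hy]]].
  rewrite periodic1_Z by exact Hp. apply HM. lra.
Qed.

Lemma cont_derive (f : R -> R) x l : is_derive f x l -> continuous f x.
Proof. intros H. apply (ex_derive_continuous f). exists l. exact H. Qed.

(** * Uniqueness of Fourier coefficients *)

Lemma cos_mult (a b : R) : cos a * cos b = / 2 * (cos (a + b) + cos (a - b)).
Proof. rewrite cos_plus, cos_minus. field. Qed.

Lemma cos_shift_Z (x : R) (k : Z) : cos (x + 2 * PI * IZR k) = cos x.
Proof.
  assert (forall n : nat, forall x, cos (x + 2 * PI * INR n) = cos x) as Hn.
  { intros n y. replace (y + 2 * PI * INR n) with (y + 2 * INR n * PI) by ring. apply cos_period. }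
  destruct (Z_le_gt_dec 0 k) as [Hk | Hk].
  - rewrite <- (Z2Nat.id k) by lia. rewrite <- INR_IZR_INZ. apply Hn.
  - rewrite <- (Hn (Z.to_nat (- k)) (x + _)). f_equal. rewrite INR_IZR_INZ, Z2Nat.id by lia.
    rewrite opp_IZR. ring.
Qed.

Lemma RInt_cos_harmonic (k : Z) (th : R) :
  RInt (fun x => cos (2 * PI * IZR k * x + th)) 0 1 = if Z.eq_dec k 0 then cos th else 0.
Proof.
  destruct (Z.eq_dec k 0) as [-> | Hk].
  - rewrite (RInt_ext _ (fun _ => cos th)).
    + rewrite RInt_const. unfold scal; simpl; unfold mult; simpl. ring.
    + intros x _. f_equal. ring.
  - assert (Hk' : IZR k <> 0) by (apply eq_IZR_contrapositive; exact Hk).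
    pose proof PI_RGT_0.
    assert (Hd : 2 * PI * IZR k <> 0) by (apply Rmult_integral_contrapositive_currified; lra).
    apply is_RInt_unique.
    replace 0 with (sin (2 * PI * IZR k * 1 + th) / (2 * PI * IZR k) - sin (2 * PI * IZR k * 0 + th) / (2 * PI * IZR k)) at 2.
    + apply (is_RInt_derive (fun x => sin (2 * PI * IZR k * x + th) / (2 * PI * IZR k))).
      * intros x _. auto_derive; [trivial|]. field. split; lra.
      * intros x _. cont.
    + rewrite <- !cos_shift.
      replace (PI / 2 - (2 * PI * IZR k * 1 + th)) with (PI / 2 - (2 * PI * IZR k * 0 + th) + 2 * PI * IZR (- k)) by (rewrite opp_IZR; ring).
      rewrite cos_shift_Z. ring.
Qed.

(** The phase [th] treats both real coefficients at once: 0 gives the cosine one and -PI/2 the sine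
    one. It also keeps the family closed under the product formula for cosines. *)
Definition coef (f : R -> R) (k : Z) (th : R) : R := RInt (fun x => f x * cos (2 * PI * IZR k * x + th)) 0 1.

Definition spectrum_null (f : R -> R) : Prop := forall k th, coef f k th = 0.

Lemma coef_ext (f g : R -> R) k th : (forall x, f x = g x) -> coef f k th = coef g k th.
Proof. intros H. apply RInt_ext. intros x _. now rewrite H. Qed.

Lemma coef_lin (f g : R -> R) a b k th : (forall x, continuous f x) -> (forall x, continuous g x) ->
  coef (fun x => a * f x + b * g x) k th = a * coef f k th + b * coef g k th.
Proof.
  intros Hf Hg. unfold coef. rewrite <- RInt_lin.
  - apply RInt_ext. intros x _. toR. ring.
  - apply ex_RInt_cont. intros; cont.
  - apply ex_RInt_cont. intros; cont.
Qed.

(** By the product formula, multiplication by a first harmonic only shifts frequencies by 1 and -1.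
    Iterated, this tests [f] against every power of [kern]. *)
Lemma spectrum_null_mult_cos (f : R -> R) (b : R) : (forall x, continuous f x) -> spectrum_null f ->
  spectrum_null (fun x => f x * cos (2 * PI * x + b)).
Proof.
  intros Hf H k th.
  pose proof (H (k + 1)%Z (th + b)) as H1. pose proof (H (k - 1)%Z (th - b)) as H2.
  unfold coef in *.
  match type of H1 with ?A = _ => match type of H2 with ?B = _ => transitivity (/ 2 * A + / 2 * B) end end;
    [|rewrite H1, H2; ring].
  rewrite <- RInt_lin by (apply ex_RInt_cont; intros; cont).
  apply RInt_ext. intros x _. toR. rewrite plus_IZR, minus_IZR.
  rewrite Rmult_assoc, (Rmult_comm (cos (_ + b))), cos_mult.
  replace (2 * PI * IZR k * x + th + (2 * PI * x + b)) with (2 * PI * (IZR k + 1) * x + (th + b)) by ring.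
  replace (2 * PI * IZR k * x + th - (2 * PI * x + b)) with (2 * PI * (IZR k - 1) * x + (th - b)) by ring.
  ring.
Qed.

(* The kernels ((1 + cos) / 2)^n concentrate at a. *)
Definition kern (a x : R) : R := (1 + cos (2 * PI * x - 2 * PI * a)) / 2.

Lemma cont_kern a x : continuous (kern a) x.
Proof. unfold kern. unfold Rdiv. cont. Qed.

Lemma kern_pow_null (f : R -> R) a n : (forall x, continuous f x) -> spectrum_null f ->
  spectrum_null (fun x => f x * kern a x ^ n).
Proof.
  intros Hf H. pose proof (cont_kern a) as Hk. induction n as [|n IH].
  - intros k th. rewrite <- (H k th). apply coef_ext. intros x. simpl. ring.
  - intros k th.
    assert (C : forall x, continuous (fun y => f y * kern a y ^ n) x) by (intros; cont).
    pose proof (spectrum_null_mult_cos _ (- (2 * PI * a)) C IH) as H2.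
    rewrite (coef_ext _ (fun x => / 2 * (f x * kern a x ^ n) + / 2 * (f x * kern a x ^ n * cos (2 * PI * x + - (2 * PI * a))))).
    + rewrite coef_lin; [rewrite IH, H2; ring | assumption | intros; cont].
    + intros x. simpl. unfold kern at 1. unfold Rminus at 1. field.
Qed.

Lemma RInt_kern_pos a n : 0 <= a <= 1 -> 0 < RInt (fun x => kern a x ^ n) 0 1.
Proof.
  intros Ha. pose proof (cont_kern a). apply (RInt_pos_point _ 0 1 a); try lra.
  - intros; cont.
  - intros x _. apply pow_le. unfold kern. pose proof (COS_bound (2 * PI * x - 2 * PI * a)). lra.
  - apply pow_lt. unfold kern. replace (_ - _) with 0 by ring. rewrite cos_0. lra.
Qed.

(* Integrate the derivative of sin * kern^n over a period. *)
Lemma RInt_kern_moment a n :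
  RInt (fun x => (1 - cos (2 * PI * x - 2 * PI * a)) * kern a x ^ n) 0 1
  = RInt (fun x => kern a x ^ n) 0 1 / INR (S n).
Proof.
  pose proof (cont_kern a) as Hk. pose proof PI_RGT_0.
  set (I := RInt (fun x => kern a x ^ n) 0 1). set (J := RInt _ 0 1).
  assert (I - INR (S n) * J = 0) as E.
  { replace (I - INR (S n) * J) with (1 * I + (- INR (S n)) * J) by ring.
    unfold I, J. rewrite <- RInt_lin by (apply ex_RInt_cont; intros; cont).
    apply is_RInt_unique.
    set (F := fun x => sin (2 * PI * x - 2 * PI * a) * kern a x ^ n / (2 * PI)).
    replace 0 with (F 1 - F 0) at 2.
    - apply (is_RInt_derive F).
      + intros x _. unfold F, kern. auto_derive; [trivial|].
        rewrite !S_INR.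
        set (c := cos _). set (s := sin _).
        (* Since s^2 = (1 - c)(1 + c) = 2 (1 - c) [kern], the factor lost in differentiating kern^n
           is restored, and the derivative of [F] becomes kern^n - (n + 1)(1 - c) kern^n. *)
        assert (Hs : s * s = 1 - c * c).
        { unfold s, c. pose proof (sin2_cos2 (2 * PI * x - 2 * PI * a)) as Q. unfold Rsqr in Q.
          replace (2 * PI * x + - (2 * PI * a)) with (2 * PI * x - 2 * PI * a) by ring. lra. }
        change (2 * PI * x - 2 * PI * a) with (2 * PI * x + - (2 * PI * a)). fold c.
        destruct n as [|m].
        * simpl. toR. field. lra.
        * rewrite S_INR. simpl Init.Nat.pred.
          replace ((1 + c) / 2) with ((1 + c) * / 2) by reflexivity.
          rewrite <- (tech_pow_Rmult _ m).
          set (P := ((1 + c) * / 2) ^ m).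
          transitivity (c * ((1+c) * /2 * P) - (INR m + 1) * (s * s) * / 2 * P); [field; lra|].
          rewrite Hs. field.
      + intros x _. cont.
    - unfold F, kern.
      replace (2 * PI * 1 - 2 * PI * a) with (- (2 * PI * a) + 2 * PI * IZR 1) by ring.
      replace (2 * PI * 0 - 2 * PI * a) with (- (2 * PI * a)) by ring.
      rewrite <- !cos_shift.
      replace (PI / 2 - (- (2 * PI * a) + 2 * PI * IZR 1)) with (PI / 2 - - (2 * PI * a) + 2 * PI * IZR (-1)) by ring.
      rewrite !cos_shift_Z. ring. }
  pose proof (lt_0_INR (S n)). apply Rmult_eq_reg_r with (INR (S n)).
  - unfold Rdiv. rewrite Rmult_assoc, Rinv_l, Rmult_1_r; [lra|]. apply not_0_INR. lia.
  - apply not_0_INR. lia.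
Qed.

(** Evenness and periodicity fold [y] into [d, 1/2], where the cosine of 2 PI y decreases. *)
Lemma one_minus_cos_lower d y : 0 < d <= 1 / 2 -> d <= Rabs y <= 1 - d -> 1 - cos (2 * PI * d) <= 1 - cos (2 * PI * y).
Proof.
  intros Hd Hy. pose proof PI_RGT_0.
  assert (cos (2 * PI * y) <= cos (2 * PI * d)); [|lra].
  replace (cos (2 * PI * y)) with (cos (2 * PI * Rabs y)).
  2: { destruct (Rcase_abs y). rewrite Rabs_left by assumption. rewrite <- cos_neg. f_equal. ring.
       now rewrite Rabs_right. }
  destruct (Rle_dec (Rabs y) (1 / 2)).
  - apply cos_decr_1; nra.
  - replace (cos (2 * PI * Rabs y)) with (cos (2 * PI * (1 - Rabs y))).
    + apply cos_decr_1; nra.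
    + rewrite <- cos_neg. rewrite <- (cos_shift_Z (2 * PI * Rabs y) (-1)). f_equal. ring.
Qed.

(** If f a > 0, then f >= f a / 2 - C (1 - cos) on [0, 1], the cosine being centred at [a].
    Integrated against kern^n, the left side gives 0 and the last term is C/(n + 1) times the
    integral of kern^n, so f a / 2 <= C/(n + 1) for every n. *)
Lemma spectrum_null_le0 (f : R -> R) a : (forall x, continuous f x) -> spectrum_null f -> 0 < a < 1 -> f a <= 0.
Proof.
  intros Hf H Ha. destruct (Rle_dec (f a) 0) as [|Hp]; [assumption|exfalso].
  assert (Hpos : 0 < f a) by lra. clear Hp.
  destruct (proj1 (cont_eps f a) (Hf a) (f a / 2)) as [d0 [Hd0 Hd0']]; [lra|].
  set (d := Rmin (d0 / 2) (Rmin a (1 - a) / 2)).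
  assert (0 < d /\ d < d0 /\ d < a /\ d < 1 - a) as (Hd & Hd1 & Hd2 & Hd3).
  { unfold d, Rmin. destruct (Rle_dec a (1-a)); destruct (Rle_dec _ _); lra. }
  destruct (continuous_bounded_itv f 0 1 Hf) as [M [HM0 HM]].
  pose proof PI_RGT_0. pose proof (cont_kern a) as Hk.
  set (c0 := 1 - cos (2 * PI * d)).
  assert (Hc0 : 0 < c0).
  { unfold c0. assert (cos (2 * PI * d) < cos 0); [|rewrite cos_0 in *; lra]. apply cos_decreasing_1; nra. }
  (* At distance at least [d] from [a] the correction is then at least M + f a, which pushes the
     lower bound below -M. *)
  set (C := (M + f a) / c0).
  assert (HC : 0 < C) by (apply Rdiv_lt_0_compat; lra).
  assert (Hlow : forall x, 0 <= x <= 1 -> f a / 2 - C * (1 - cos (2 * PI * x - 2 * PI * a)) <= f x).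
  { intros x Hx. replace (2 * PI * x - 2 * PI * a) with (2 * PI * (x - a)) by ring.
    destruct (Rlt_dec (Rabs (x - a)) d) as [Hxa | Hxa].
    - assert (Hr : Rabs (f x - f a) < f a / 2) by (apply Hd0'; lra). apply Rabs_def2 in Hr.
      pose proof (COS_bound (2 * PI * (x - a))). nra.
    - assert (Hr : c0 <= 1 - cos (2 * PI * (x - a))).
      { apply one_minus_cos_lower; [split; lra|]. split; [lra|]. apply Rabs_le. lra. }
      assert (C * c0 = M + f a) by (unfold C; field; lra).
      assert (C * c0 <= C * (1 - cos (2 * PI * (x - a)))) by (apply Rmult_le_compat_l; lra).
      specialize (HM x Hx). apply Rabs_le_between in HM. lra. }
  assert (Hn : forall n, f a / 2 <= C / INR (S n)).
  { intros n. pose proof (RInt_kern_pos a n ltac:(lra)) as HI. set (I := RInt _ 0 1) in HI.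
    apply Rmult_le_reg_r with I; [exact HI|].
    assert (E0 : RInt (fun x => f x * kern a x ^ n) 0 1 = 0).
    { transitivity (coef (fun x => f x * kern a x ^ n) 0 0); [|now apply kern_pow_null]. unfold coef. apply RInt_ext. intros x _.
      replace (2 * PI * 0 * x + 0) with 0 by ring. rewrite cos_0. toR. ring. }
    assert (E1 : RInt (fun x => f a / 2 * kern a x ^ n + - C * ((1 - cos (2 * PI * x - 2 * PI * a)) * kern a x ^ n)) 0 1 <= 0).
    { apply Rle_trans with (RInt (fun x => f x * kern a x ^ n) 0 1); [|rewrite E0; apply Rle_refl].
      apply RInt_le; [lra | apply ex_RInt_cont; intros; cont | apply ex_RInt_cont; intros; cont |].
      intros x Hx. assert (0 <= kern a x ^ n).
      { apply pow_le. unfold kern. pose proof (COS_bound (2 * PI * x - 2 * PI * a)). lra. }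
      specialize (Hlow x ltac:(lra)).
      replace (f a / 2 * kern a x ^ n + - C * ((1 - cos (2 * PI * x - 2 * PI * a)) * kern a x ^ n))
        with ((f a / 2 - C * (1 - cos (2 * PI * x - 2 * PI * a))) * kern a x ^ n) by ring.
      apply Rmult_le_compat_r; lra. }
    rewrite RInt_lin in E1 by (apply ex_RInt_cont; intros; cont).
    rewrite RInt_kern_moment in E1. fold I in E1. unfold Rdiv in *. lra. }
  destruct (INR_unbounded (C / (f a / 2))) as [n Hn'].
  specialize (Hn n). rewrite S_INR in Hn.
  assert (0 <= INR n) by apply pos_INR.
  apply (Rmult_lt_compat_r (f a / 2)) in Hn'; [|lra].
  unfold Rdiv in Hn' at 1. rewrite Rmult_assoc, Rinv_l, Rmult_1_r in Hn' by lra.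
  apply (Rmult_le_compat_r (INR n + 1)) in Hn; [|lra].
  replace (C / (INR n + 1) * (INR n + 1)) with C in Hn by (field; lra). lra.
Qed.

(** The one-sided bound is applied to [f] and to -f. *)
Lemma spectrum_null_zero (f : R -> R) : periodic1 f -> (forall x, continuous f x) -> spectrum_null f -> forall x, f x = 0.
Proof.
  intros Hp Hf H.
  assert (Hin : forall a, 0 < a < 1 -> f a = 0).
  { intros a Ha. apply Rle_antisym.
    - now apply spectrum_null_le0.
    - assert (H2 : spectrum_null (fun x => -1 * f x + 0 * f x)) by (intros k th; rewrite coef_lin, H by assumption; ring).
      assert (H3 : -1 * f a + 0 * f a <= 0); [|lra].
      apply (spectrum_null_le0 (fun x => -1 * f x + 0 * f x)); [intros; cont | exact H2 | exact Ha]. }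
  (* The previous bound reaches interior points of the period only; the endpoint follows by
     continuity. *)
  assert (H0 : f 0 = 0).
  { destruct (Req_dec (f 0) 0) as [|Hne]; [assumption|exfalso].
    apply Rabs_pos_lt in Hne.
    destruct (proj1 (cont_eps f 0) (Hf 0) _ Hne) as [d [Hd Hd']].
    set (y := Rmin (d / 2) (1 / 2)). assert (0 < y /\ y < d /\ y < 1) as (? & ? & ?).
    { unfold y, Rmin. destruct (Rle_dec _ _); lra. }
    specialize (Hd' y). rewrite Hin in Hd' by lra.
    rewrite Rminus_0_r, Rabs_right in Hd' by lra.
    rewrite Rminus_0_l, Rabs_Ropp in Hd'. lra. }
  intros x. destruct (unit_reduction x) as [k [y [-> Hy]]]. rewrite periodic1_Z by exact Hp.
  destruct (Req_dec y 0) as [->|]; [exact H0|]. apply Hin. lra.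
Qed.

(** * Reconstruction from the Fourier coefficients *)

Lemma Rle_eps (a b : R) : (forall eps, 0 < eps -> a <= b + eps) -> a <= b.
Proof. intros H. apply Rnot_lt_le. intros Hlt. specialize (H ((a - b) / 2)). lra. Qed.

Lemma Req_eps (a b : R) : (forall eps, 0 < eps -> Rabs (a - b) <= eps) -> a = b.
Proof.
  intros H. assert (Rabs (a - b) <= 0) as H0.
  { apply Rle_eps. intros eps He. specialize (H eps He). lra. }
  apply Rabs_le_between in H0. lra.
Qed.

Lemma ex_series_tail (M : nat -> R) : ex_series M -> forall eps, 0 < eps -> exists N, forall n, (N <= n)%nat ->
  Rabs (Series M - sum_n M n) < eps.
Proof.
  intros [l Hl] eps He. rewrite (is_series_unique _ _ Hl).
  destruct (proj1 (filterlim_locally (sum_n M) l) Hl (mkposreal eps He)) as [N HN].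
  exists N. intros n Hn. rewrite Rabs_minus_sym. exact (HN n Hn).
Qed.

Lemma Series_tail_le (a M : nat -> R) n : (forall k, Rabs (a k) <= M k) -> ex_series M ->
  Rabs (Series a - sum_n a n) <= Series M - sum_n M n.
Proof.
  intros H HM.
  assert (Ha : ex_series (fun k => Rabs (a k))).
  { apply (@ex_series_le R_AbsRing R_CompleteNormedModule) with M; [|exact HM]. intros k.
    change (Rabs (Rabs (a k)) <= M k). rewrite Rabs_Rabsolu. apply H. }
  rewrite (Series_incr_n a (S n)), (Series_incr_n M (S n)); try lia; [|exact HM|now apply ex_series_Rabs].
  rewrite <- !sum_n_Reals. simpl Init.Nat.pred.
  replace (sum_n a n + Series (fun k => a (S n + k)%nat) - sum_n a n) with (Series (fun k => a (S n + k)%nat)) by ring.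
  replace (sum_n M n + Series (fun k => M (S n + k)%nat) - sum_n M n) with (Series (fun k => M (S n + k)%nat)) by ring.
  assert (Ha' : ex_series (fun k => Rabs (a (S n + k)%nat))) by (apply (ex_series_incr_n (fun k => Rabs (a k))); exact Ha).
  eapply Rle_trans; [apply Series_Rabs; exact Ha'|].
  apply Series_le; [|apply (ex_series_incr_n M); exact HM].
  intros k. split; [apply Rabs_pos | apply H].
Qed.

(** * Series of functions dominated by a summable sequence (Weierstrass M-test) *)

Section FunctionSeries.
Variables (u : nat -> R -> R) (M : nat -> R).
Hypothesis u_cont : forall n x, continuous (u n) x.
Hypothesis u_le : forall n x, Rabs (u n x) <= M n.
Hypothesis M_sum : ex_series M.

Definition fseries (x : R) : R := Series (fun n => u n x).

Definition fsum (N : nat) (x : R) : R := sum_n (fun n => u n x) N.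

Lemma fseries_unif eps : 0 < eps -> exists N, forall n, (N <= n)%nat -> forall x, Rabs (fseries x - fsum n x) <= eps.
Proof.
  intros He. destruct (ex_series_tail M M_sum eps He) as [N HN]. exists N. intros n Hn x.
  eapply Rle_trans; [apply Series_tail_le with (M := M); [intros; apply u_le | exact M_sum]|].
  specialize (HN n Hn). apply Rabs_def2 in HN. lra.
Qed.

Lemma fseries_abs_le x : Rabs (fseries x) <= Series M.
Proof.
  assert (ex_series (fun k => Rabs (u k x))).
  { apply (@ex_series_le R_AbsRing R_CompleteNormedModule) with M; [|exact M_sum]. intros k.
    change (Rabs (Rabs (u k x)) <= M k). rewrite Rabs_Rabsolu. apply u_le. }
  eapply Rle_trans; [apply Series_Rabs; assumption|]. apply Series_le; [|exact M_sum].
  intros n. split; [apply Rabs_pos | apply u_le].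
Qed.

Lemma cont_fsum N x : continuous (fsum N) x.
Proof.
  unfold fsum. induction N as [|N IH].
  - apply (continuous_ext (u 0%nat)); [|apply u_cont]. intros y. now rewrite sum_O.
  - apply (continuous_ext (fun y => sum_n (fun n => u n y) N + u (S N) y)).
    + intros y. now rewrite sum_Sn.
    + apply cont_plus; [exact IH | apply u_cont].
Qed.

Lemma cont_fseries x : continuous fseries x.
Proof.
  apply cont_eps. intros eps He. destruct (fseries_unif (eps / 4)) as [N HN]; [lra|].
  specialize (HN N (Nat.le_refl N)).
  destruct (proj1 (cont_eps _ x) (cont_fsum N x) (eps / 4)) as [d [Hd Hd']]; [lra|].
  exists d. split; [exact Hd|]. intros y Hy. specialize (Hd' y Hy).
  pose proof (HN x) as H1. pose proof (HN y) as H2.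
  apply Rabs_le_between in H1, H2. apply Rabs_def2 in Hd'. apply Rabs_def1; lra.
Qed.

(** Two test functions [h] will be used: the constant 1, for termwise differentiation, and a
    harmonic, for the Fourier coefficients of a sum. *)
Lemma RInt_fsum_approx (h : R -> R) a b eps : a <= b -> (forall x, continuous h x) -> (forall x, Rabs (h x) <= 1) -> 0 < eps ->
  exists N, forall n, (N <= n)%nat ->
   Rabs (RInt (fun x => fseries x * h x) a b - RInt (fun x => fsum n x * h x) a b) <= (b - a) * eps.
Proof.
  intros Hab Hc Hh He. destruct (fseries_unif eps He) as [N HN]. exists N. intros n Hn.
  pose proof cont_fseries as C1. pose proof (cont_fsum n) as C2.
  replace (RInt (fun x => fseries x * h x) a b - RInt (fun x => fsum n x * h x) a b)
    with (1 * RInt (fun x => fseries x * h x) a b + (-1) * RInt (fun x => fsum n x * h x) a b) by ring.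
  rewrite <- RInt_lin by (apply ex_RInt_cont; intros; cont).
  apply abs_RInt_le_const; [lra | apply ex_RInt_cont; intros; cont |].
  intros x _. replace (_ + _) with ((fseries x - fsum n x) * h x) by ring. rewrite Rabs_mult.
  rewrite <- (Rmult_1_r eps). apply Rmult_le_compat; auto using Rabs_pos.
Qed.
End FunctionSeries.

(** The fundamental theorem of calculus for partial sums passes to the uniform limit, so [fseries u]
    is a primitive of the continuous function [fseries du]. *)
Lemma fseries_derive (u du : nat -> R -> R) (M M' : nat -> R) :
  (forall n x, is_derive (u n) x (du n x)) -> (forall n x, continuous (du n) x) ->
  (forall n x, Rabs (u n x) <= M n) -> ex_series M ->
  (forall n x, Rabs (du n x) <= M' n) -> ex_series M' ->
  forall x, is_derive (fseries u) x (fseries du x).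
Proof.
  intros Hd Hdc Hu HM Hdu HM'.
  pose proof (cont_fseries du M' Hdc Hdu HM') as C.
  assert (Hsum : forall N x y, RInt (fsum du N) x y = fsum u N y - fsum u N x).
  { intros N x y. apply is_RInt_unique. apply (is_RInt_derive (fsum u N)); intros z _.
    - unfold fsum. apply (is_derive_sum_n u N z (fun n => du n z)). intros; apply Hd.
    - now apply cont_fsum. }
  assert (Hint : forall x y, x <= y -> RInt (fseries du) x y = fseries u y - fseries u x).
  { intros x y Hxy. apply Req_eps. intros eps He.
    (* The denominator y - x + 1 stays positive when x = y and still keeps the integrated error
       below eps / 2. *)
    destruct (RInt_fsum_approx du M' Hdc Hdu HM' (fun _ => 1) x y (eps / 2 / (y - x + 1)) Hxy) as [N1 HN1].
    { intros; apply continuous_const. } { intros; rewrite Rabs_R1; lra. }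
    { apply Rdiv_lt_0_compat; lra. }
    destruct (fseries_unif u M Hu HM (eps / 4)) as [N2 HN2]; [lra|].
    specialize (HN1 (max N1 N2) ltac:(lia)). specialize (HN2 (max N1 N2) ltac:(lia)).
    rewrite (RInt_ext _ (fseries du)) in HN1 by (intros; toR; ring).
    rewrite (RInt_ext (fun x => fsum _ _ x * 1) (fsum du (max N1 N2))) in HN1 by (intros; toR; ring).
    rewrite Hsum in HN1. pose proof (HN2 x) as H1. pose proof (HN2 y) as H2.
    assert ((y - x) * (eps / 2 / (y - x + 1)) <= eps / 2).
    { replace ((y - x) * (eps / 2 / (y - x + 1))) with (eps / 2 * ((y - x) / (y - x + 1))) by (field; lra).
      rewrite <- (Rmult_1_r (eps / 2)) at 2. apply Rmult_le_compat_l; [lra|].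
      apply Rle_div_l; lra. }
    apply Rabs_le_between in HN1, H1, H2. apply Rabs_le. lra. }
  intros x.
  (* [Hint] needs ordered endpoints; the base point x - 1 lies to the left of a whole neighbourhood
     of [x]. *)
  apply (is_derive_ext_loc (fun y => fseries u (x - 1) + RInt (fseries du) (x - 1) y)).
  - exists (mkposreal 1 Rlt_0_1). intros y Hy. change (Rabs (y - x) < 1) in Hy. apply Rabs_def2 in Hy. toR.
    rewrite Hint by lra. ring.
  - rewrite <- (Rplus_0_l (fseries du x)). apply (is_derive_plus (fun _ => fseries u (x - 1))).
    + exact (@is_derive_const R_AbsRing R_NormedModule (fseries u (x - 1)) x).
    + apply (is_derive_RInt (fseries du) (RInt (fseries du) (x - 1)) (x - 1)) ; [|apply C].
      exists (mkposreal 1 Rlt_0_1). intros y _. apply RInt_correct_R. now apply ex_RInt_cont.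
Qed.

(** The modulus of the n-th complex Fourier coefficient; [f] is real, so nonnegative frequencies
    carry all the information. *)
Definition amp (f : R -> R) (n : nat) : R := sqrt (coef f (Z.of_nat n) 0 ^ 2 + coef f (Z.of_nat n) (- (PI / 2)) ^ 2).

(** For real [f] the frequencies n and -n merge into one real term, hence the weight 2 except at
    frequency 0. *)
Definition mult2 (n : nat) : R := match n with O => 1 | _ => 2 end.

Definition fterm (f : R -> R) (n : nat) (x : R) : R :=
  mult2 n * (coef f (Z.of_nat n) 0 * cos (2 * PI * INR n * x) + coef f (Z.of_nat n) (- (PI / 2)) * sin (2 * PI * INR n * x)).

Definition fterm' (f : R -> R) (n : nat) (x : R) : R :=
  mult2 n * (2 * PI * INR n) * (coef f (Z.of_nat n) (- (PI / 2)) * cos (2 * PI * INR n * x) + - coef f (Z.of_nat n) 0 * sin (2 * PI * INR n * x)).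

(** The squares of a cos x + b sin x and a sin x - b cos x add up to a^2 + b^2. *)
Lemma cos_sin_le a b x : Rabs (a * cos x + b * sin x) <= sqrt (a ^ 2 + b ^ 2).
Proof.
  rewrite <- sqrt_Rsqr_abs. apply sqrt_le_1_alt. unfold Rsqr.
  pose proof (sin2_cos2 x) as H. unfold Rsqr in H.
  assert ((a * cos x + b * sin x) * (a * cos x + b * sin x) + (a * sin x - b * cos x) * (a * sin x - b * cos x) = a ^ 2 + b ^ 2).
  { transitivity ((a ^ 2 + b ^ 2) * (sin x * sin x + cos x * cos x)); [ring | rewrite H; ring]. }
  pose proof (Rle_0_sqr (a * sin x - b * cos x)) as H2. unfold Rsqr in H2. lra.
Qed.

Lemma mult2_bound n : 0 <= mult2 n <= 2.
Proof. destruct n; simpl; lra. Qed.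

Lemma freq_pos n : 0 <= 2 * PI * INR n.
Proof. pose proof PI_RGT_0. pose proof (pos_INR n). apply Rmult_le_pos; lra. Qed.

Lemma amp_pos f n : 0 <= amp f n.
Proof. apply sqrt_pos. Qed.

Lemma fterm_le f n x : Rabs (fterm f n x) <= 2 * amp f n.
Proof.
  unfold fterm. rewrite Rabs_mult. pose proof (mult2_bound n). rewrite (Rabs_right (mult2 n)) by lra.
  apply Rmult_le_compat; try lra; [apply Rabs_pos | apply cos_sin_le].
Qed.

Lemma fterm'_le f n x : Rabs (fterm' f n x) <= 2 * (2 * PI * INR n * amp f n).
Proof.
  unfold fterm'. rewrite !Rabs_mult. pose proof (mult2_bound n). rewrite (Rabs_right (mult2 n)) by lra.
  pose proof PI_RGT_0. pose proof (pos_INR n).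
  rewrite (Rabs_right 2), (Rabs_right PI), (Rabs_right (INR n)) by lra.
  rewrite <- (Rmult_assoc 2 (2 * PI * INR n)).
  pose proof (freq_pos n).
  apply Rmult_le_compat; [| apply Rabs_pos | |].
  - apply Rmult_le_pos; lra.
  - apply Rmult_le_compat_r; lra.
  - eapply Rle_trans; [apply cos_sin_le|]. unfold amp. apply sqrt_le_1_alt. lra.
Qed.

Lemma fterm_derive f n x : is_derive (fterm f n) x (fterm' f n x).
Proof. unfold fterm, fterm'. auto_derive; [trivial|]. ring. Qed.

Lemma cont_sin (f : R -> R) x : continuous f x -> continuous (fun y => sin (f y)) x.
Proof. intros; apply (continuous_comp f sin); [assumption | apply continuous_sin]. Qed.

Lemma cont_fterm f n x : continuous (fterm f n) x.
Proof. exact (cont_derive _ _ _ (fterm_derive f n x)). Qed.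

Lemma cont_fterm' f n x : continuous (fterm' f n) x.
Proof. apply (ex_derive_continuous (fterm' f n)). unfold fterm'. auto_derive. trivial. Qed.

Lemma coef_phase f k th : (forall x, continuous f x) -> coef f k th = cos th * coef f k 0 - sin th * coef f k (- (PI / 2)).
Proof.
  intros Hf. unfold Rminus. rewrite Ropp_mult_distr_l. unfold coef.
  rewrite <- RInt_lin by (apply ex_RInt_cont; intros; cont).
  apply RInt_ext. intros x _. toR. rewrite Rplus_0_r, (cos_plus _ th).
  replace (cos (2 * PI * IZR k * x + - (PI / 2))) with (sin (2 * PI * IZR k * x)); [ring|].
  rewrite <- cos_shift, <- cos_neg. f_equal. ring.
Qed.

Lemma coef_opp f k th : coef f (- k) th = coef f k (- th).
Proof.
  unfold coef. apply RInt_ext. intros x _. toR. f_equal. rewrite <- cos_neg. f_equal. rewrite opp_IZR. ring.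
Qed.

Lemma RInt_cos_cos (n m : Z) (a b : R) :
  RInt (fun x => cos (2 * PI * IZR n * x + a) * cos (2 * PI * IZR m * x + b)) 0 1 =
  / 2 * (if Z.eq_dec (n + m) 0 then cos (a + b) else 0) + / 2 * (if Z.eq_dec (n - m) 0 then cos (a - b) else 0).
Proof.
  rewrite <- !RInt_cos_harmonic. rewrite <- RInt_lin by (apply ex_RInt_cont; intros; cont).
  apply RInt_ext. intros x _. rewrite cos_mult. rewrite plus_IZR, minus_IZR. toR.
  rewrite <- Rmult_plus_distr_l. f_equal. f_equal; f_equal; ring.
Qed.

(** Orthogonality of the harmonics; the weight [mult2] makes the projection exact. *)
Lemma coef_fterm f n m th : (forall x, continuous f x) ->
  coef (fterm f n) (Z.of_nat m) th = if Nat.eq_dec n m then coef f (Z.of_nat m) th else 0.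
Proof.
  intros Hf.
  set (A := coef f (Z.of_nat n) 0). set (B := coef f (Z.of_nat n) (- (PI / 2))).
  assert (E : coef (fterm f n) (Z.of_nat m) th = mult2 n * A * RInt (fun x => cos (2 * PI * IZR (Z.of_nat n) * x + 0) * cos (2 * PI * IZR (Z.of_nat m) * x + th)) 0 1
     + mult2 n * B * RInt (fun x => cos (2 * PI * IZR (Z.of_nat n) * x + - (PI / 2)) * cos (2 * PI * IZR (Z.of_nat m) * x + th)) 0 1).
  { rewrite <- RInt_lin by (apply ex_RInt_cont; intros; cont). apply RInt_ext. intros x _. toR.
    unfold fterm. fold A B. rewrite <- !INR_IZR_INZ.
    replace (cos (2 * PI * INR n * x + - (PI / 2))) with (sin (2 * PI * INR n * x)).
    - rewrite Rplus_0_r. ring.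
    - rewrite <- cos_shift, <- cos_neg. f_equal. ring. }
  rewrite E, !RInt_cos_cos. destruct (Nat.eq_dec n m) as [->|Hne].
  - rewrite (coef_phase f (Z.of_nat m) th Hf). fold A B.
    destruct (Z.eq_dec (Z.of_nat m - Z.of_nat m) 0) as [_|]; [|lia].
    replace (cos (- (PI / 2) - th)) with (- sin th).
    2: { rewrite <- cos_neg, <- sin_neg, <- cos_shift. f_equal. ring. }
    replace (cos (0 - th)) with (cos th) by (rewrite <- cos_neg; f_equal; ring).
    (* At frequency 0 both resonances, of the sum and of the difference, occur and compensate for
       the weight 1. The sine coefficient vanishes there. *)
    destruct m as [|m].
    + simpl. replace (cos (- (PI / 2) + th)) with (sin th).
      2: { rewrite <- cos_shift, <- cos_neg. f_equal. ring. }
      rewrite Rplus_0_l. assert (B = 0).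
      { unfold B, coef. rewrite (RInt_ext _ (fun _ => 0)).
        - rewrite RInt_const. apply Rmult_0_r.
        - intros x _. toR. simpl IZR. replace (2 * PI * 0 * x + - (PI / 2)) with (- (PI / 2)) by ring.
          rewrite cos_neg, cos_PI2. ring. }
      rewrite H. field.
    + destruct (Z.eq_dec _ 0) as [H0|_]; [lia|]. simpl mult2. field.
  - destruct (Z.eq_dec _ 0) as [H0|_].
    + assert (n = 0 /\ m = 0)%nat by lia. lia.
    + destruct (Z.eq_dec _ 0) as [H0|_]; [lia|]. ring.
Qed.

Lemma coef_fsum f N m th : (forall x, continuous f x) ->
  coef (fsum (fterm f) N) (Z.of_nat m) th = if le_dec m N then coef f (Z.of_nat m) th else 0.
Proof.
  intros Hf. induction N as [|N IH].
  - rewrite (coef_ext _ (fterm f 0)) by (intros; unfold fsum; now rewrite sum_O).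
    rewrite coef_fterm by exact Hf. destruct (Nat.eq_dec 0 m), (le_dec m 0); try lia; reflexivity.
  - rewrite (coef_ext _ (fun x => 1 * fsum (fterm f) N x + 1 * fterm f (S N) x)).
    + rewrite coef_lin, IH, coef_fterm; try assumption.
      * destruct (Nat.eq_dec (S N) m), (le_dec m N), (le_dec m (S N)); try lia; ring.
      * intros. apply cont_fsum. intros; apply cont_fterm.
      * intros. apply cont_fterm.
    + intros x. unfold fsum. rewrite sum_Sn. change plus with Rplus. rewrite !Rmult_1_l. reflexivity.
Qed.

(** Uniform convergence lets the coefficients be computed termwise, so [f] and its Fourier series
    have the same spectrum and uniqueness applies to their difference. *)
Lemma reconstruction f : periodic1 f -> (forall x, continuous f x) -> ex_series (amp f) ->
  forall x, f x = fseries (fterm f) x.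
Proof.
  intros Hp Hf Ha.
  assert (Ha2 : ex_series (fun n => 2 * amp f n)) by exact (ex_series_scal 2 _ Ha).
  pose proof (cont_fseries (fterm f) _ (cont_fterm f) (fterm_le f) Ha2) as HS.
  assert (Hnat : forall m th, coef (fseries (fterm f)) (Z.of_nat m) th = coef f (Z.of_nat m) th).
  { intros m th. apply Req_eps. intros eps He.
    destruct (RInt_fsum_approx (fterm f) _ (cont_fterm f) (fterm_le f) Ha2 (fun x => cos (2 * PI * IZR (Z.of_nat m) * x + th)) 0 1 eps) as [N HN]; try lra.
    - intros; cont.
    - intros x. apply Rabs_le. apply COS_bound.
    (* From index [m] on, the partial sums have exactly the coefficient of [f] at frequency [m]. *)
    - specialize (HN (max N m) ltac:(lia)).
      change (Rabs (coef (fseries (fterm f)) (Z.of_nat m) th - coef (fsum (fterm f) (max N m)) (Z.of_nat m) th) <= (1 - 0) * eps) in HN.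
      rewrite coef_fsum in HN by exact Hf. destruct (le_dec _ _); [lra|lia]. }
  assert (Hnull : spectrum_null (fun x => 1 * f x + (-1) * fseries (fterm f) x)).
  { intros k th. rewrite coef_lin by assumption.
    assert (coef (fseries (fterm f)) k th = coef f k th); [|lra].
    destruct (Z_le_gt_dec 0 k).
    - rewrite <- (Z2Nat.id k) by assumption. apply Hnat.
    - replace k with (- Z.of_nat (Z.to_nat (- k)))%Z by lia. rewrite !coef_opp. apply Hnat. }
  intros x.
  assert (1 * f x + (-1) * fseries (fterm f) x = 0); [|lra].
  apply (spectrum_null_zero (fun x => 1 * f x + (-1) * fseries (fterm f) x)); [|intros; cont|exact Hnull].
  intros y. rewrite Hp. f_equal. f_equal. apply Series_ext. intros n. unfold fterm.
  replace (2 * PI * INR n * (y + 1)) with (2 * PI * INR n * y + 2 * INR n * PI) by ring.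
  now rewrite cos_period, sin_period.
Qed.

Lemma sup_le_amp f : periodic1 f -> (forall x, continuous f x) -> ex_series (amp f) ->
  forall x, Rabs (f x) <= 2 * Series (amp f).
Proof.
  intros Hp Hf Ha x. rewrite (reconstruction f Hp Hf Ha x). rewrite <- Series_scal_l.
  apply fseries_abs_le; [apply fterm_le | exact (ex_series_scal 2 _ Ha)].
Qed.

(** The weight 1 + 2 PI n dominates both the terms of the series and those of its derivative, so one
    hypothesis serves both. *)
Lemma derive_amp f : periodic1 f -> (forall x, continuous f x) -> ex_series (fun n => (1 + 2 * PI * INR n) * amp f n) ->
  forall x, ex_derive f x /\ continuous (Derive f) x /\ Rabs (Derive f x) <= 2 * Series (fun n => (1 + 2 * PI * INR n) * amp f n).
Proof.
  intros Hp Hf Ha. pose proof PI_RGT_0.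
  pose proof freq_pos as Hw.
  assert (H0 : ex_series (amp f)).
  { apply (@ex_series_le R_AbsRing R_CompleteNormedModule) with (2 := Ha). intros n.
    change (Rabs (amp f n) <= (1 + 2 * PI * INR n) * amp f n). pose proof (amp_pos f n). rewrite Rabs_right by lra.
    specialize (Hw n). nra. }
  assert (Ha2 : ex_series (fun n => 2 * amp f n)) by exact (ex_series_scal 2 _ H0).
  assert (Ha3 : ex_series (fun n => 2 * ((1 + 2 * PI * INR n) * amp f n))) by exact (ex_series_scal 2 _ Ha).
  assert (Hb : forall n x, Rabs (fterm' f n x) <= 2 * ((1 + 2 * PI * INR n) * amp f n)).
  { intros n x. eapply Rle_trans; [apply fterm'_le|]. pose proof (amp_pos f n). specialize (Hw n). nra. }
  assert (D : forall x, is_derive f x (fseries (fterm' f) x)).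
  { intros x. apply (is_derive_ext (fseries (fterm f))).
    - intros; symmetry; now apply reconstruction.
    - apply fseries_derive with (1 := fterm_derive f) (2 := cont_fterm' f) (3 := fterm_le f) (4 := Ha2) (5 := Hb) (6 := Ha3). }
  intros x. split; [eexists; apply D|].
  split.
  - apply (continuous_ext (fseries (fterm' f))); [intros; symmetry; apply is_derive_unique, D|].
    apply cont_fseries with (1 := cont_fterm' f) (2 := Hb) (3 := Ha3).
  - rewrite (is_derive_unique _ _ _ (D x)). rewrite <- Series_scal_l.
    apply fseries_abs_le; [apply Hb | exact Ha3].
Qed.

(** * Sobolev embeddings *)

Lemma ex_series_le_pos (a b : nat -> R) : (forall n, 0 <= a n <= b n) -> ex_series b -> ex_series a.
Proof.
  intros H. apply (@ex_series_le R_AbsRing R_CompleteNormedModule). intros n.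
  change (Rabs (a n) <= b n). rewrite Rabs_right; [|apply Rle_ge]; apply H.
Qed.

Lemma ex_series_telescope (a b : nat -> R) : (forall n, 0 <= a n <= b n - b (S n)) -> (forall n, 0 <= b n) -> ex_series a.
Proof.
  intros Ha Hb.
  assert (H : ex_finite_lim_seq (sum_n a)).
  { apply ex_finite_lim_seq_incr with (b 0%nat).
    - intros n. rewrite sum_Sn. change plus with Rplus. specialize (Ha (S n)). lra.
    - intros n. apply Rle_trans with (b 0%nat - b (S n)); [|specialize (Hb (S n)); lra].
      induction n as [|n IH].
      + rewrite sum_O. apply Ha.
      + rewrite sum_Sn. change plus with Rplus. specialize (Ha (S n)). lra. }
  destruct H as [l Hl]. exists l. exact Hl.
Qed.

Lemma Rpower_le_neg (x y e : R) : 0 < x <= y -> e <= 0 -> Rpower y e <= Rpower x e.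
Proof.
  intros Hxy He. unfold Rpower. destruct (Req_dec x y) as [->|Hne]; [lra|].
  assert (ln x < ln y) by (apply ln_increasing; lra).
  destruct (Req_dec e 0) as [->|]; [rewrite !Rmult_0_l; lra|].
  left. apply exp_increasing. nra.
Qed.

Lemma ln_lower z : 0 < z -> 1 - / z <= ln z.
Proof.
  intros Hz. pose proof (exp_ineq1_le (- ln z)) as H. rewrite exp_Ropp, exp_ln in H by exact Hz. lra.
Qed.

(** A telescoping form of the integral test. *)
Lemma ex_series_Rpower (al : R) : 1 < al -> ex_series (fun n => Rpower (INR n + 1) (- al)).
Proof.
  intros Hal. apply ex_series_incr_1.
  (* Up to sign this is the primitive of x^(-al), evaluated at n + 1. *)
  apply ex_series_telescope with (fun n => / (al - 1) * Rpower (INR n + 1) (1 - al)).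
  2: { intros n. apply Rmult_le_pos; [left; apply Rinv_0_lt_compat; lra | left; apply exp_pos]. }
  intros n. split; [left; apply exp_pos|]. rewrite !S_INR. pose proof (pos_INR n).
  set (x := INR n + 1). set (y := x + 1). assert (1 <= x) by (unfold x; lra).
  rewrite <- Rmult_minus_distr_l. apply Rmult_le_reg_l with (al - 1); [lra|].
  rewrite <- Rmult_assoc, Rinv_r, Rmult_1_l by lra.
  assert (Ey : Rpower y (1 - al) = y * Rpower y (- al)).
  { unfold Rminus. rewrite Rpower_plus, Rpower_1 by (unfold y; lra). reflexivity. }
  assert (Ex : Rpower x (1 - al) = Rpower y (1 - al) * exp ((al - 1) * ln (y / x))).
  { unfold Rpower. rewrite <- exp_plus. f_equal. rewrite ln_div by (unfold y; lra). ring. }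
  rewrite Ex, Ey.
  (* From exp z >= 1 + z and ln (y/x) >= 1 - x/y = 1/y, as y = x + 1. *)
  assert (1 + (al - 1) / y <= exp ((al - 1) * ln (y / x))).
  { eapply Rle_trans; [|apply exp_ineq1_le]. apply Rplus_le_compat_l. unfold Rdiv at 1.
    apply Rmult_le_compat_l; [lra|]. eapply Rle_trans; [|apply ln_lower; apply Rdiv_lt_0_compat; unfold y; lra].
    right. unfold y. field. lra. }
  pose proof (exp_pos (- al * ln y)) as Hp. fold (Rpower y (- al)) in Hp.
  set (w := Rpower y (- al)) in *.
  apply Rle_trans with (y * w * ((1 + (al - 1) / y) - 1)).
  - right. field. unfold y; lra.
  - replace (y * w * exp ((al - 1) * ln (y / x)) - y * w) with (y * w * (exp ((al - 1) * ln (y / x)) - 1)) by ring.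
    apply Rmult_le_compat_l; [apply Rmult_le_pos; unfold y; lra | lra].
Qed.

Definition bracket (n : nat) : R := 1 + (2 * PI * INR n) ^ 2.

Lemma bracket_pos n : 1 <= bracket n.
Proof. unfold bracket. pose proof (pow2_ge_0 (2 * PI * INR n)). lra. Qed.

(** The bracket grows at least like (n + 1)^2, so the sum is compared with exponent 2 rho; this is
    where the Sobolev threshold 1/2 arises. *)
Lemma ex_series_bracket (rho : R) : 1 / 2 < rho -> ex_series (fun n => Rpower (bracket n) (- rho)).
Proof.
  intros Hr. apply ex_series_le_pos with (fun n => Rpower (INR n + 1) (- (2 * rho))).
  - intros n. split; [left; apply exp_pos|].
    pose proof (pos_INR n) as Hn.
    replace (Rpower (INR n + 1) (- (2 * rho))) with (Rpower ((INR n + 1) ^ 2) (- rho)).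
    2: { rewrite <- (Rpower_pow 2) by lra. rewrite Rpower_mult. f_equal. simpl. ring. }
    apply Rpower_le_neg; [|lra]. split; [apply pow_lt; lra|].
    unfold bracket. pose proof PI2_1. destruct n as [|n]; [simpl; lra|].
    rewrite S_INR in *. pose proof (pos_INR n).
    assert (2 * (INR n + 1) <= 2 * PI * (INR n + 1)) by nra. nra.
  - apply ex_series_Rpower. lra.
Qed.

Lemma Cmod_sqr (z : C) : Cmod z ^ 2 = fst z ^ 2 + snd z ^ 2.
Proof. unfold Cmod. rewrite pow2_sqrt; [reflexivity|]. pose proof (pow2_ge_0 (fst z)). pose proof (pow2_ge_0 (snd z)). lra. Qed.

Lemma Cmod_fourier f n : Cmod (fourier f (Z.of_nat n)) ^ 2 = amp f n ^ 2.
Proof.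
  rewrite Cmod_sqr. unfold amp. rewrite pow2_sqrt.
  2: { apply Rplus_le_le_0_compat; apply pow2_ge_0. }
  unfold fourier, coef. simpl fst. simpl snd.
  replace (RInt (fun x => f x * cos (2 * PI * IZR (Z.of_nat n) * x)) 0 1)
    with (RInt (fun x => f x * cos (2 * PI * IZR (Z.of_nat n) * x + 0)) 0 1).
  2: { apply RInt_ext. intros x _. toR. now rewrite Rplus_0_r. }
  replace (RInt (fun x => f x * sin (2 * PI * IZR (Z.of_nat n) * x)) 0 1)
    with (RInt (fun x => f x * cos (2 * PI * IZR (Z.of_nat n) * x + - (PI / 2))) 0 1); [ring|].
  apply RInt_ext. intros x _. toR. f_equal. rewrite <- cos_shift, <- (cos_neg (PI / 2 - _)). f_equal. ring.
Qed.

Lemma Hs_term_pos s f k : 0 <= Hs_term s f k.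
Proof. unfold Hs_term. apply Rmult_le_pos; [left; apply exp_pos | apply pow2_ge_0]. Qed.

Lemma foldZ_pos s f n : 0 <= foldZ (Hs_term s f) n.
Proof.
  destruct n; simpl; [apply Hs_term_pos|]. apply Rplus_le_le_0_compat; apply Hs_term_pos.
Qed.

Lemma amp_le_foldZ s f n : Rpower (bracket n) s * amp f n ^ 2 <= foldZ (Hs_term s f) n.
Proof.
  assert (E : Rpower (bracket n) s * amp f n ^ 2 = Hs_term s f (Z.of_nat n)).
  { rewrite <- Cmod_fourier. unfold Hs_term, bracket. now rewrite INR_IZR_INZ. }
  rewrite E. destruct n as [|n]; [apply Rle_refl|].
  unfold foldZ. pose proof (Hs_term_pos s f (- Z.of_nat (S n))). lra.
Qed.

Lemma foldZ_le (a b c : Z -> R) l m : (forall k, a k <= l * b k + m * c k) -> forall n, foldZ a n <= l * foldZ b n + m * foldZ c n.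
Proof. intros H [|n]; [apply H|]. unfold foldZ. pose proof (H (Z.of_nat (S n))). pose proof (H (- Z.of_nat (S n))%Z). lra. Qed.

Lemma ex_RInt_fourier_cos f (k : Z) : (forall x, continuous f x) -> ex_RInt (fun x => f x * cos (2 * PI * IZR k * x)) 0 1.
Proof. intros. apply ex_RInt_cont. intros; cont. Qed.

Lemma ex_RInt_fourier_sin f (k : Z) : (forall x, continuous f x) -> ex_RInt (fun x => f x * sin (2 * PI * IZR k * x)) 0 1.
Proof. intros. apply ex_RInt_cont. intros. apply cont_mult; [cont|]. apply cont_sin. cont. Qed.

(** Termwise, |aX + bY|^2 <= 2 a^2 |X|^2 + 2 b^2 |Y|^2. Membership matters because [Series] gives 0
    on a divergent nonnegative series: a small [Hs_norm] of a difference or a difference quotient is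
    informative only once that function is known to lie in [Hs]. *)
Lemma Hs_linear s f g a b : Hs s f -> Hs s g -> Hs s (fun x => a * f x + b * g x).
Proof.
  intros (Pf & Cf & Sf) (Pg & Cg & Sg). split; [|split].
  - intros x. now rewrite Pf, Pg.
  - intros; cont.
  - apply ex_series_le_pos with (fun n => 2 * a ^ 2 * foldZ (Hs_term s f) n + 2 * b ^ 2 * foldZ (Hs_term s g) n).
    + intros n. split; [apply foldZ_pos|]. apply foldZ_le. intros k. unfold Hs_term. rewrite !Cmod_sqr.
      unfold fourier; simpl fst; simpl snd.
      replace (RInt (fun x => (a * f x + b * g x) * cos (2 * PI * IZR k * x)) 0 1) with
        (a * RInt (fun x => f x * cos (2 * PI * IZR k * x)) 0 1 + b * RInt (fun x => g x * cos (2 * PI * IZR k * x)) 0 1).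
      2: { rewrite <- RInt_lin by (apply ex_RInt_fourier_cos; assumption). apply RInt_ext. intros; toR; ring. }
      replace (RInt (fun x => (a * f x + b * g x) * sin (2 * PI * IZR k * x)) 0 1) with
        (a * RInt (fun x => f x * sin (2 * PI * IZR k * x)) 0 1 + b * RInt (fun x => g x * sin (2 * PI * IZR k * x)) 0 1).
      2: { rewrite <- RInt_lin by (apply ex_RInt_fourier_sin; assumption). apply RInt_ext. intros; toR; ring. }
      set (X := RInt _ 0 1). set (Y := RInt _ 0 1). set (Z := RInt _ 0 1). set (W := RInt _ 0 1).
      set (w := Rpower _ _). assert (0 <= w) by (left; apply exp_pos).
      replace (2 * a ^ 2 * (w * (X ^ 2 + (- Z) ^ 2)) + 2 * b ^ 2 * (w * (Y ^ 2 + (- W) ^ 2)))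
        with (w * (2 * a ^ 2 * (X ^ 2 + (- Z) ^ 2) + 2 * b ^ 2 * (Y ^ 2 + (- W) ^ 2))) by ring.
      apply Rmult_le_compat_l; [assumption|].
      pose proof (pow2_ge_0 (a * X - b * Y)). pose proof (pow2_ge_0 (a * Z - b * W)). nra.
    + exact (ex_series_plus _ _ (ex_series_scal (2 * a ^ 2) _ Sf) (ex_series_scal (2 * b ^ 2) _ Sg)).
Qed.

Lemma Hs_norm_sqr s f : Hs s f -> Hs_norm s f ^ 2 = Series (foldZ (Hs_term s f)).
Proof.
  intros (_ & _ & H). unfold Hs_norm. apply pow2_sqrt. rewrite <- (Rmult_0_l (Series (foldZ (Hs_term s f)))).
  rewrite <- Series_scal_l. apply Series_le; [|exact H]. intros n. pose proof (foldZ_pos s f n). lra.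
Qed.

(* Weighted Cauchy-Schwarz, in the form of AM-GM with a free parameter eta. *)
Lemma weighted_amp (s : R) (h : nat -> R) : (forall n, 0 <= h n) -> ex_series (fun n => h n ^ 2 * Rpower (bracket n) (- s)) ->
  forall f, Hs s f -> ex_series (fun n => h n * amp f n) /\
   forall eta, 0 < eta -> 2 * Series (fun n => h n * amp f n) <= Hs_norm s f ^ 2 / eta + eta * Series (fun n => h n ^ 2 * Rpower (bracket n) (- s)).
Proof.
  intros Hh HK f Hf.
  assert (P : forall eta, 0 < eta -> forall n, 0 <= 2 * (h n * amp f n) <= / eta * foldZ (Hs_term s f) n + eta * (h n ^ 2 * Rpower (bracket n) (- s))).
  { intros eta He n. split; [pose proof (Hh n); pose proof (amp_pos f n); assert (0 <= h n * amp f n) by (apply Rmult_le_pos; lra); lra|].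
    eapply Rle_trans; [|apply Rplus_le_compat_r, Rmult_le_compat_l; [left; now apply Rinv_0_lt_compat | apply amp_le_foldZ]].
    rewrite Rpower_Ropp. set (w := Rpower _ s). assert (Hw : 0 < w) by apply exp_pos.
    set (A := amp f n). set (H := h n).
    (* Completing the square: the gap in the inequality is the last, nonnegative term. *)
    replace (/ eta * (w * A ^ 2) + eta * (H ^ 2 * / w)) with (2 * (H * A) + / (eta * w) * (w * A - eta * H) ^ 2) by (field; lra).
    assert (0 <= / (eta * w) * (w * A - eta * H) ^ 2); [|lra].
    apply Rmult_le_pos; [left; apply Rinv_0_lt_compat; nra | apply pow2_ge_0]. }
  assert (E : forall eta, 0 < eta -> ex_series (fun n => / eta * foldZ (Hs_term s f) n + eta * (h n ^ 2 * Rpower (bracket n) (- s)))).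
  { intros eta _. exact (ex_series_plus _ _ (ex_series_scal (/ eta) _ (proj2 (proj2 Hf))) (ex_series_scal eta _ HK)). }
  split.
  - apply (ex_series_ext (fun n => / 2 * (2 * (h n * amp f n)))); [intros n; toR; field|].
    apply (@ex_series_scal R_AbsRing R_NormedModule (/ 2) (fun n => 2 * (h n * amp f n))).
    eapply ex_series_le_pos; [apply (P 1); lra | apply (E 1); lra].
  - intros eta He. rewrite <- Series_scal_l.
    eapply Rle_trans; [apply Series_le; [apply (P eta He) | apply (E eta He)]|].
    rewrite Series_plus.
    + rewrite !Series_scal_l, Hs_norm_sqr by exact Hf. right. unfold Rdiv. change (Series (fun n => foldZ (Hs_term s f) n)) with (Series (foldZ (Hs_term s f))). ring.
    + exact (ex_series_scal (/ eta) _ (proj2 (proj2 Hf))).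
    + exact (ex_series_scal eta _ HK).
Qed.

(** First [eta] is taken small against [K], then [N] small against [eta]. Writing K + 1 covers K =
    0. *)
Lemma eta_choice (K eps : R) : 0 <= K -> 0 < eps -> exists eta d, 0 < eta /\ 0 < d /\ forall N, 0 <= N < d -> N ^ 2 / eta + eta * K <= eps.
Proof.
  intros HK He. set (eta := eps / (2 * (K + 1))).
  assert (Heta : 0 < eta) by (apply Rdiv_lt_0_compat; lra).
  exists eta, (sqrt (eta * eps / 2)). split; [exact Heta|]. split; [apply sqrt_lt_R0; nra|].
  intros N [H0 HN].
  assert (N ^ 2 <= eta * eps / 2).
  { rewrite <- (pow2_sqrt (eta * eps / 2)) by nra. apply pow_incr. lra. }
  assert (N ^ 2 / eta <= eps / 2). { apply Rle_div_l; [exact Heta|]. lra. }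
  assert (eta * K <= eps / 2).
  { apply Rle_trans with (eta * (K + 1)); [nra|]. right. unfold eta. field. lra. }
  lra.
Qed.

Lemma Hs_norm_pos s f : 0 <= Hs_norm s f.
Proof. apply sqrt_pos. Qed.

Lemma Series_pos a : (forall n, 0 <= a n) -> ex_series a -> 0 <= Series a.
Proof.
  intros H He. rewrite <- (Rmult_0_l (Series a)). rewrite <- Series_scal_l. apply Series_le; [|exact He].
  intros n. specialize (H n). lra.
Qed.

(** Continuity of the embedding at 0, in epsilon-delta form: it follows at once from the AM-GM bound
    with weight 1, and convergence statements use it in this shape. *)
Lemma sobolev_sup (s : R) : 1 / 2 < s -> forall eps, 0 < eps -> exists d, 0 < d /\
  forall f, Hs s f -> Hs_norm s f < d -> forall x, Rabs (f x) <= eps.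
Proof.
  intros Hs12 eps He.
  assert (HK : ex_series (fun n => 1 ^ 2 * Rpower (bracket n) (- s))).
  { apply (ex_series_ext (fun n => Rpower (bracket n) (- s))); [intros; toR; ring|]. now apply ex_series_bracket. }
  assert (HK0 : 0 <= Series (fun n => 1 ^ 2 * Rpower (bracket n) (- s))).
  { apply Series_pos; [|exact HK]. intros n. apply Rmult_le_pos; [lra | left; apply exp_pos]. }
  destruct (eta_choice _ eps HK0 He) as (eta & d & Heta & Hd & H).
  exists d. split; [exact Hd|]. intros f Hf Hn x.
  destruct (weighted_amp s (fun _ => 1) ltac:(intros; lra) HK f Hf) as [Ha Hb].
  assert (Ha' : ex_series (amp f)) by (eapply ex_series_ext; [|exact Ha]; intros; toR; simpl; ring).
  eapply Rle_trans; [apply sup_le_amp; [apply Hf | apply Hf | exact Ha']|].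
  rewrite (Series_ext (amp f) (fun n => 1 * amp f n)) by (intros; ring).
  eapply Rle_trans; [apply (Hb eta Heta)|]. apply H. split; [apply Hs_norm_pos | exact Hn].
Qed.

(** The weight for one derivative satisfies h^2 <= 2 [bracket], which costs one unit of the
    exponent: the sum converges when s - 1 > 1/2. *)
Lemma sobolev_C1 (s : R) : 3 / 2 < s ->
  (forall f, Hs s f -> forall x, ex_derive f x /\ continuous (Derive f) x) /\
  forall eps, 0 < eps -> exists d, 0 < d /\
  forall f, Hs s f -> Hs_norm s f < d -> forall x, Rabs (Derive f x) <= eps.
Proof.
  intros Hs32. set (h := fun n => 1 + 2 * PI * INR n).
  assert (Hh : forall n, 0 <= h n) by (intros n; pose proof (freq_pos n); unfold h; lra).
  assert (HK : ex_series (fun n => h n ^ 2 * Rpower (bracket n) (- s))).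
  { apply ex_series_le_pos with (fun n => 2 * Rpower (bracket n) (- (s - 1))).
    - intros n. pose proof (exp_pos (- s * ln (bracket n))) as Hp. fold (Rpower (bracket n) (- s)) in Hp.
      split; [apply Rmult_le_pos; [apply pow2_ge_0 | lra]|].
      replace (- (s - 1)) with (1 + - s) by ring. pose proof (bracket_pos n).
      rewrite Rpower_plus, Rpower_1, <- Rmult_assoc by lra.
      apply Rmult_le_compat_r; [lra|]. unfold h, bracket. pose proof (pow2_ge_0 (1 - 2 * PI * INR n)). nra.
    - apply (@ex_series_scal R_AbsRing R_NormedModule 2 (fun n => Rpower (bracket n) (- (s - 1)))). apply ex_series_bracket. lra. }
  assert (HK0 : 0 <= Series (fun n => h n ^ 2 * Rpower (bracket n) (- s))).
  { apply Series_pos; [|exact HK]. intros n. apply Rmult_le_pos; [apply pow2_ge_0 | left; apply exp_pos]. }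
  split.
  - intros f Hf x. destruct (weighted_amp s h Hh HK f Hf) as [Ha _].
    destruct (derive_amp f (proj1 Hf) (proj1 (proj2 Hf)) Ha x) as (A & B & _). split; assumption.
  - intros eps He. destruct (eta_choice _ eps HK0 He) as (eta & d & Heta & Hd & H).
    exists d. split; [exact Hd|]. intros f Hf Hn x.
    destruct (weighted_amp s h Hh HK f Hf) as [Ha Hb].
    destruct (derive_amp f (proj1 Hf) (proj1 (proj2 Hf)) Ha x) as (_ & _ & B).
    eapply Rle_trans; [apply B|].
    eapply Rle_trans; [apply (Hb eta Heta)|]. apply H. split; [apply Hs_norm_pos | exact Hn].
Qed.

(** * The kernel p *)

Lemma RInt_shift (f : R -> R) a b c : (forall x, continuous f x) -> RInt (fun y => f (y + c)) a b = RInt f (a + c) (b + c).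
Proof.
  intros Hf. rewrite <- (Rmult_1_l a) at 2. rewrite <- (Rmult_1_l b) at 2.
  rewrite <- (RInt_comp_lin f 1 c a b) by now apply ex_RInt_cont.
  apply RInt_ext. intros x _. change (f (x + c) = 1 * f (1 * x + c)). now rewrite !Rmult_1_l.
Qed.

Lemma cont_exp (f : R -> R) x : continuous f x -> continuous (fun y => exp (f y)) x.
Proof. intros; apply (continuous_comp f exp); [assumption | apply continuous_exp]. Qed.

(** On the window [x - 1, x] the difference x - y runs through [0, 1], so the integer part
    disappears from the kernel and the hyperbolic cosine splits into two exponentials. *)
Definition expconv (s : R) (g : R -> R) (x : R) : R := RInt (fun y => exp (s * (x - y - 1 / 2)) * g y) (x - 1) x.

Definition Sh : R := 2 * sinh (1 / 2).

(** This is p * g for continuous periodic [g], as [conv_p_Pk] shows. *)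
Definition Pk (g : R -> R) (x : R) : R := (expconv 1 g x + expconv (-1) g x) / (2 * Sh).

(** The same convolution with sinh in place of cosh, which is the derivative of p * g. *)
Definition Qk (g : R -> R) (x : R) : R := (expconv 1 g x - expconv (-1) g x) / (2 * Sh).

Lemma Sh_pos : 0 < Sh.
Proof. unfold Sh. rewrite <- (Rmult_0_r 2). apply Rmult_lt_compat_l; [lra|]. rewrite <- sinh_0. apply sinh_lt. lra. Qed.

Lemma Sh_exp : Sh = exp (1 / 2) - exp (- (1 / 2)).
Proof. unfold Sh, sinh. field. Qed.

Section Kernel.
Variable g : R -> R.
Hypothesis Hp : periodic1 g.
Hypothesis Hg : forall x, continuous g x.

Lemma cont_expconv_integrand s x y : continuous (fun y => exp (s * (x - y - 1 / 2)) * g y) y.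
Proof. apply cont_mult; [apply cont_exp; cont | apply Hg]. Qed.

Lemma expconv_derive s (x : R) : is_derive (expconv s g) x (s * expconv s g x + (exp (- s / 2) - exp (s / 2)) * g x).
Proof.
  set (k := fun y => exp (- s * y) * g y).
  assert (Ck : forall y, continuous k y) by (intros y; apply cont_mult; [apply cont_exp; cont | apply Hg]).
  (* Pulling out the factor that depends on [x] leaves a fixed integrand [k] with moving
     endpoints. *)
  assert (E : forall x, expconv s g x = exp (s * (x - 1 / 2)) * (RInt k 0 x - RInt k 0 (x - 1))).
  { intros z. rewrite <- (RInt_Chasles_R k 0 (z - 1) z Ck).
    replace (RInt k 0 (z - 1) + RInt k (z - 1) z - RInt k 0 (z - 1)) with (RInt k (z - 1) z) by (symmetry; apply Rplus_minus_l).
    rewrite <- RInt_mulc by now apply ex_RInt_cont. apply RInt_ext. intros y _. toR. unfold k.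
    rewrite <- Rmult_assoc, <- exp_plus. f_equal. f_equal. ring. }
  assert (D : forall z, is_derive (fun x => RInt k 0 x) z (k z)).
  { intros z. apply (is_derive_RInt k (fun x => RInt k 0 x) 0); [|apply Ck].
    exists (mkposreal 1 Rlt_0_1). intros y _. apply RInt_correct_R. now apply ex_RInt_cont. }
  apply (is_derive_ext (fun x => exp (s * (x - 1 / 2)) * (RInt k 0 x - RInt k 0 (x - 1)))); [intros; symmetry; apply E|].
  assert (D2 : is_derive (fun x => RInt k 0 (x - 1)) x (k (x - 1))).
  { replace (k (x - 1)) with (1 * k (x - 1)) by ring.
    apply (is_derive_comp (fun x => RInt k 0 x) (fun x => x - 1)); [apply D|]. auto_derive; [trivial|reflexivity]. }
  rewrite E.
  replace (s * (exp (s * (x - 1 / 2)) * (RInt k 0 x - RInt k 0 (x - 1))) + (exp (- s / 2) - exp (s / 2)) * g x)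
    with (s * exp (s * (x - 1 / 2)) * (RInt k 0 x - RInt k 0 (x - 1)) + exp (s * (x - 1 / 2)) * (k x - k (x - 1))).
  - apply (is_derive_mult (fun x => exp (s * (x - 1 / 2))) (fun x => RInt k 0 x - RInt k 0 (x - 1))).
    + auto_derive; [trivial|]. unfold Rminus. ring.
    + apply (is_derive_minus (fun x => RInt k 0 x) (fun x => RInt k 0 (x - 1))); [apply D | exact D2].
    + intros; apply Rmult_comm.
  (* Periodicity of [g] merges the two endpoint terms into a multiple of g x. *)
  - unfold k. rewrite <- (Hp (x - 1)). replace (x - 1 + 1) with x by ring.
    rewrite (Rmult_assoc s). f_equal. rewrite <- Rmult_minus_distr_r, <- Rmult_assoc. f_equal.
    rewrite Rmult_minus_distr_l, <- !exp_plus. f_equal; f_equal; field.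
Qed.

Lemma expconv_periodic s : periodic1 (expconv s g).
Proof.
  intros x. unfold expconv. replace (x + 1 - 1) with (x - 1 + 1) by ring.
  rewrite <- (RInt_shift (fun y => exp (s * (x + 1 - y - 1 / 2)) * g y)).
  - apply RInt_ext. intros y _. toR. rewrite Hp. f_equal. f_equal. ring.
  - intros y. apply cont_expconv_integrand.
Qed.

Lemma Pk_periodic : periodic1 (Pk g).
Proof. intros x. unfold Pk. now rewrite !expconv_periodic. Qed.

(** The endpoint terms for s = 1 and s = -1 are opposite and cancel in the sum, reflecting the
    continuity of p. *)
Lemma Pk_derive (x : R) : is_derive (Pk g) x (Qk g x).
Proof.
  pose proof Sh_pos. unfold Pk, Qk.
  pose proof (expconv_derive 1 x) as D1. pose proof (expconv_derive (-1) x) as D2.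
  auto_derive.
  - split; [eexists; exact D1 | split; [eexists; exact D2 | trivial]].
  - apply is_derive_unique in D1, D2. change (fun x => expconv 1 g x) with (expconv 1 g). change (fun x => expconv (-1) g x) with (expconv (-1) g). rewrite D1, D2.
    replace (- (1) / 2) with (- (1 / 2)) by field. replace (-1 / 2) with (- (1 / 2)) by field. replace (- -1 / 2) with (1 / 2) by field.
    field. lra.
Qed.

(** In the difference the endpoint terms add up to -g, the jump of p'. Thus p inverts 1 - d^2/dx^2,
    and p * g gains two derivatives. *)
Lemma Qk_derive (x : R) : is_derive (Qk g) x (Pk g x - g x).
Proof.
  pose proof Sh_pos. unfold Pk, Qk.
  pose proof (expconv_derive 1 x) as D1. pose proof (expconv_derive (-1) x) as D2.
  auto_derive.
  - split; [eexists; exact D1 | split; [eexists; exact D2 | trivial]].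
  - apply is_derive_unique in D1, D2. change (fun x => expconv 1 g x) with (expconv 1 g). change (fun x => expconv (-1) g x) with (expconv (-1) g). rewrite D1, D2.
    replace (- (1) / 2) with (- (1 / 2)) by field. replace (-1 / 2) with (- (1 / 2)) by field. replace (- -1 / 2) with (1 / 2) by field.
    replace (exp (1 / 2)) with (Sh + exp (- (1 / 2))) by (rewrite Sh_exp; ring).
    field. lra.
Qed.

Lemma Pk_comb c x : Pk g x + c * Qk g x = RInt (fun y => ((1 + c) * exp (x - y - 1 / 2) + (1 - c) * exp (- (x - y - 1 / 2))) * g y) (x - 1) x / (2 * Sh).
Proof.
  pose proof Sh_pos.
  transitivity (((1 + c) * expconv 1 g x + (1 - c) * expconv (-1) g x) / (2 * Sh)).
  - unfold Pk, Qk. field. lra.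
  - f_equal. unfold expconv. rewrite <- RInt_lin by (apply ex_RInt_cont; intros; apply cont_expconv_integrand).
    apply RInt_ext. intros y _. toR. replace (1 * (x - y - 1 / 2)) with (x - y - 1 / 2) by ring.
    replace (-1 * (x - y - 1 / 2)) with (- (x - y - 1 / 2)) by ring. ring.
Qed.

(** In the worst cases c = 3/2 and c = -3/2 the coefficients are 5/2 and -1/2, while the two
    exponentials differ by a factor of at most e <= 3 < 5. *)
Lemma comb_pos c z : -3 / 2 <= c <= 3 / 2 -> - (1 / 2) <= z <= 1 / 2 -> 0 < (1 + c) * exp z + (1 - c) * exp (- z).
Proof.
  intros Hc Hz. pose proof exp_le_3 as H3. pose proof (exp_pos z). pose proof (exp_pos (- z)).
  assert (Hm : forall z, - (1 / 2) <= z -> exp (- z) <= 3 * exp z).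
  { intros w Hw. replace (exp (- w)) with (exp (- 2 * w) * exp w) by (rewrite <- exp_plus; f_equal; ring).
    apply Rmult_le_compat_r; [left; apply exp_pos|]. eapply Rle_trans; [|exact H3].
    destruct (Req_dec (- 2 * w) 1) as [->|]; [lra|]. left. apply exp_increasing. lra. }
  pose proof (Hm z ltac:(lra)) as A. pose proof (Hm (- z) ltac:(lra)) as B. rewrite Ropp_involutive in B. nra.
Qed.

Lemma cont_comb c x y : continuous (fun y => ((1 + c) * exp (x - y - 1 / 2) + (1 - c) * exp (- (x - y - 1 / 2))) * g y) y.
Proof. apply cont_mult; [apply cont_plus; (apply cont_mult; [apply continuous_const | apply cont_exp; cont])| apply Hg]. Qed.

Lemma Pk_comb_nonneg c x : -3 / 2 <= c <= 3 / 2 -> (forall y, 0 <= g y) -> 0 <= Pk g x + c * Qk g x.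
Proof.
  intros Hc Hpos. pose proof Sh_pos. rewrite Pk_comb. apply Rmult_le_pos; [|left; apply Rinv_0_lt_compat; lra].
  apply RInt_ge_0; [lra | apply ex_RInt_cont; intros; apply cont_comb|].
  intros y Hy. apply Rmult_le_pos; [|apply Hpos]. left. apply comb_pos; lra.
Qed.

Lemma Pk_comb_pos c x y0 : -3 / 2 <= c <= 3 / 2 -> (forall y, 0 <= g y) -> 0 < g y0 -> 0 < Pk g x + c * Qk g x.
Proof.
  intros Hc Hpos H0. pose proof Sh_pos. rewrite Pk_comb. apply Rmult_lt_0_compat; [|apply Rinv_0_lt_compat; lra].
  (* An integer translation brings [y0] into the integration window. *)
  destruct (unit_reduction (y0 - (x - 1))) as [k [w [E Hw]]].
  apply (RInt_pos_point _ (x - 1) x (w + (x - 1))); [lra | intros; apply cont_comb | | lra |].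
  - intros y Hy. apply Rmult_le_pos; [|apply Hpos]. left. apply comb_pos; lra.
  - apply Rmult_lt_0_compat; [apply comb_pos; lra|].
    rewrite <- (periodic1_Z g Hp k). replace (w + (x - 1) + IZR k) with y0 by lra. exact H0.
Qed.

Lemma p_periodic_Z (k : Z) x : p (x + IZR k) = p x.
Proof.
  unfold p. rewrite <- (Int_part_spec (x + IZR k) (Int_part x + k)).
  - rewrite plus_IZR. f_equal. f_equal. ring.
  - rewrite plus_IZR. pose proof (base_Int_part x). lra.
Qed.

Lemma cosh_exp x y : cosh (x - y - 1 / 2) * g y / Sh = / (2 * Sh) * (exp (1 * (x - y - 1 / 2)) * g y) + / (2 * Sh) * (exp (-1 * (x - y - 1 / 2)) * g y).
Proof. pose proof Sh_pos. unfold cosh. replace (-1 * (x - y - 1 / 2)) with (- (x - y - 1 / 2)) by ring. rewrite Rmult_1_l. field. lra. Qed.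

(** For [w] in [0, 1) the integer part of w - y jumps at y = w: it is 0 on (0, w) and -1 on (w, 1).
    Moving the second piece by one period gives a single smooth integrand on [w - 1, w]. *)
Lemma conv_p_Pk x : conv p g x = Pk g x.
Proof.
  pose proof Sh_pos.
  destruct (unit_reduction x) as [k [w [-> Hw]]].
  rewrite (periodic1_Z _ Pk_periodic k).
  transitivity (conv p g w).
  { apply RInt_ext. intros y _. toR. f_equal. rewrite <- (p_periodic_Z k (w - y)). f_equal. ring. }
  set (K := fun y => cosh (w - y - 1 / 2) * g y / Sh).
  assert (CK : forall y, continuous K y).
  { intros y. apply (continuous_ext (fun y => / (2 * Sh) * (exp (1 * (w - y - 1 / 2)) * g y) + / (2 * Sh) * (exp (-1 * (w - y - 1 / 2)) * g y))).
    - intros; symmetry; apply cosh_exp.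
    - apply cont_plus; (apply cont_mult; [apply continuous_const | apply cont_expconv_integrand]). }
  transitivity (RInt K (w - 1) w).
  2: { unfold K. rewrite (RInt_ext _ _ _ _ (fun y _ => cosh_exp w y)).
       rewrite RInt_lin by (apply ex_RInt_cont; intros; apply cont_expconv_integrand).
       unfold Pk, expconv. field. lra. }
  rewrite <- (RInt_Chasles_R K (w - 1) 0 w CK).
  replace (w - 1) with (w + -1) by ring. replace 0 with (1 + -1) at 1 by ring.
  rewrite <- (RInt_shift K w 1 (-1) CK). rewrite Rplus_comm.
  assert (CK' : forall y, continuous (fun y => K (y + -1)) y) by (intros; cont).
  apply is_RInt_unique. apply (is_RInt_Chasles (fun y => p (w - y) * g y) 0 w 1).
  - apply (is_RInt_ext K); [|now apply RInt_correct_R, ex_RInt_cont].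
    intros y Hy. rewrite Rmin_left, Rmax_right in Hy by lra. unfold K, p.
    rewrite <- (Int_part_spec (w - y) 0) by lra. rewrite Rminus_0_r. unfold Sh. toR. field. unfold Sh in *. lra.
  - apply (is_RInt_ext (fun y => K (y + -1))); [|now apply RInt_correct_R, ex_RInt_cont].
    intros y Hy. rewrite Rmin_left, Rmax_right in Hy by lra. unfold K, p.
    rewrite <- (Int_part_spec (w - y) (-1)) by lra.
    rewrite <- (Hp (y + -1)). replace (y + -1 + 1) with y by ring.
    replace (w - (y + -1) - 1 / 2) with (w - y - -1 - 1 / 2) by ring. unfold Sh. toR. field. unfold Sh in *. lra.
Qed.

End Kernel.

Lemma expconv_lin s f g a b x : (forall x, continuous f x) -> (forall x, continuous g x) ->
  expconv s (fun y => a * f y + b * g y) x = a * expconv s f x + b * expconv s g x.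
Proof.
  intros Hf Hg. unfold expconv. rewrite <- RInt_lin by (apply ex_RInt_cont; intros; now apply cont_expconv_integrand).
  apply RInt_ext. intros y _. toR. ring.
Qed.

Lemma Qk_lin f g a b x : (forall x, continuous f x) -> (forall x, continuous g x) ->
  Qk (fun y => a * f y + b * g y) x = a * Qk f x + b * Qk g x.
Proof. intros Hf Hg. unfold Qk. rewrite !expconv_lin by assumption. pose proof Sh_pos. field. lra. Qed.

Lemma Pk_lin f g a b x : (forall x, continuous f x) -> (forall x, continuous g x) ->
  Pk (fun y => a * f y + b * g y) x = a * Pk f x + b * Pk g x.
Proof. intros Hf Hg. unfold Pk. rewrite !expconv_lin by assumption. pose proof Sh_pos. field. lra. Qed.

(** Both exponentials have the same integral over a symmetric window. This removes the constant left
    by completing the square in the source. *)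
Lemma Qk_one x : Qk (fun _ => 1) x = 0.
Proof.
  assert (E : forall s, s <> 0 -> expconv s (fun _ => 1) x = (exp (s / 2) - exp (- s / 2)) / s).
  { intros s Hs. unfold expconv. apply is_RInt_unique.
    replace ((exp (s / 2) - exp (- s / 2)) / s) with ((- / s * exp (s * (x - x - 1 / 2))) - (- / s * exp (s * (x - (x - 1) - 1 / 2)))).
    - apply (is_RInt_derive (fun y => - / s * exp (s * (x - y - 1 / 2)))).
      + intros y _. auto_derive; [trivial|]. unfold Rminus; toR; field. exact Hs.
      + intros y _. apply cont_expconv_integrand. intros; apply continuous_const.
    - replace (s * (x - x - 1 / 2)) with (- s / 2) by field. replace (s * (x - (x - 1) - 1 / 2)) with (s / 2) by field. field. exact Hs. }
  unfold Qk. rewrite !E by lra. replace (- -1 / 2) with (1 / 2) by field. replace (-1 / 2) with (- (1) / 2) by field.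
  pose proof Sh_pos. field. lra.
Qed.

Lemma expconv_le s g M x : (forall x, continuous g x) -> -1 <= s <= 1 -> 0 <= M -> (forall y, Rabs (g y) <= M) -> Rabs (expconv s g x) <= 3 * M.
Proof.
  intros Hg Hs HM H. unfold expconv. replace (3 * M) with ((x - (x - 1)) * (3 * M)) by ring.
  apply abs_RInt_le_const; [lra | apply ex_RInt_cont; intros; now apply cont_expconv_integrand |].
  intros y Hy. rewrite Rabs_mult. rewrite (Rabs_right (exp _)) by (left; apply exp_pos).
  apply Rmult_le_compat; [left; apply exp_pos | apply Rabs_pos | | apply H].
  eapply Rle_trans; [|apply exp_le_3]. left. apply exp_increasing. nra.
Qed.

Lemma Pk_le g M x : (forall x, continuous g x) -> 0 <= M -> (forall y, Rabs (g y) <= M) -> Rabs (Pk g x) <= 3 / Sh * M /\ Rabs (Qk g x) <= 3 / Sh * M.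
Proof.
  intros Hg HM H. pose proof Sh_pos.
  pose proof (expconv_le 1 g M x Hg ltac:(lra) HM H) as A. pose proof (expconv_le (-1) g M x Hg ltac:(lra) HM H) as B.
  assert (forall a, Rabs a <= 6 * M -> Rabs (a / (2 * Sh)) <= 3 / Sh * M) as R.
  { intros a Ha. unfold Rdiv. rewrite Rabs_mult, (Rabs_right (/ _)) by (left; apply Rinv_0_lt_compat; lra).
    replace (3 * / Sh * M) with (6 * M * / (2 * Sh)) by (field; lra). apply Rmult_le_compat_r; [left; apply Rinv_0_lt_compat; lra | exact Ha]. }
  apply Rabs_le_between in A, B. split; apply R; apply Rabs_le; lra.
Qed.

(** * A Riccati inequality and global flows *)

Lemma is_derive_RInt_cont (f : R -> R) (a t : R) : (forall x, continuous f x) -> is_derive (fun t => RInt f a t) t (f t).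
Proof.
  intros Hf. apply (is_derive_RInt f (fun t => RInt f a t) a); [|apply Hf].
  exists (mkposreal 1 Rlt_0_1). intros y _. apply RInt_correct_R. now apply ex_RInt_cont.
Qed.

Lemma MVT_cont (f df : R -> R) a b : a <= b -> (forall t, a < t < b -> is_derive f t (df t)) -> (forall t, continuous f t) ->
  exists c, a <= c <= b /\ f b - f a = df c * (b - a).
Proof.
  intros Hab Hd Hc. destruct (MVT_gen f a b df) as [c [H1 H2]].
  - rewrite Rmin_left, Rmax_right by lra. exact Hd.
  - intros t _. apply continuity_pt_filterlim. apply Hc.
  - rewrite Rmin_left, Rmax_right in H1 by lra. now exists c.
Qed.

Section Riccati.
Variables a g P Q : R -> R.
Hypothesis (Ca : forall t, continuous a t) (Cg : forall t, continuous g t) (CP : forall t, continuous P t) (CQ : forall t, continuous Q t).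
Hypothesis Da : forall t, 0 < t -> is_derive a t (- Q t).
Hypothesis Dg : forall t, 0 < t -> is_derive g t (- g t ^ 2 + 3 / 2 * a t ^ 2 - P t).

(** [E] is the integrating factor for A' + A B, and 3/4 = c^2 - 3/2. Strictness at time 0 turns a
    weak initial inequality into a strict one at every later time. *)
Lemma cone_invariant (c : R) : c ^ 2 = 9 / 4 -> g 0 + c * a 0 <= 0 -> (forall t, 0 <= t -> 0 <= P t + c * Q t) -> 0 < P 0 + c * Q 0 ->
  forall t, 0 < t -> g t + c * a t < 0.
Proof.
  intros Hc H0 HPQ HPQ0.
  set (B := fun t => g t - c * a t).
  assert (CB : forall t, continuous B t) by (intros; unfold B; cont).
  set (E := fun t => exp (RInt B 0 t)).
  assert (DE : forall t, is_derive E t (B t * E t)).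
  { intros t. apply (is_derive_comp exp (fun t => RInt B 0 t)); [apply is_derive_exp|]. now apply is_derive_RInt_cont. }
  assert (CE : forall t, continuous E t) by (intros t; exact (cont_derive _ _ _ (DE t))).
  set (Y := fun t => (g t + c * a t) * E t).
  set (dY := fun t => (- (3 / 4) * a t ^ 2 - (P t + c * Q t)) * E t).
  assert (CY : forall t, continuous Y t) by (intros; unfold Y; cont).
  assert (CdY : forall t, continuous dY t) by (intros; unfold dY; cont).
  assert (DY : forall t, 0 < t -> is_derive Y t (dY t)).
  { intros t Ht. unfold Y.
    replace (dY t) with (((- g t ^ 2 + 3 / 2 * a t ^ 2 - P t) + c * (- Q t)) * E t + (g t + c * a t) * (B t * E t)).
    - apply (is_derive_mult (fun t => g t + c * a t) E).
      + apply (is_derive_plus g (fun t => c * a t)); [now apply Dg|]. apply (is_derive_scal a t c). now apply Da.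
      + apply DE.
      + intros; apply Rmult_comm.
    - unfold dY, B. replace (3 / 4) with (c ^ 2 - 3 / 2) by lra. ring. }
  assert (HE : forall t, 0 < E t) by (intros; apply exp_pos).
  assert (NdY : forall t, 0 <= t -> dY t <= 0).
  { intros t Ht. unfold dY. specialize (HPQ t Ht). pose proof (pow2_ge_0 (a t)). specialize (HE t). nra. }
  assert (dY 0 < 0).
  { unfold dY. pose proof (pow2_ge_0 (a 0)). specialize (HE 0). nra. }
  assert (HY : forall t, 0 < t -> Y t < 0).
  (* [Y] decreases strictly on a short interval [0, s], where dY < 0 by continuity, and does not
     increase on [s, t]. *)
  { destruct (proj1 (cont_eps dY 0) (CdY 0) (- dY 0)) as [d [Hd Hd']]; [lra|].
    intros t Ht. set (s := Rmin (d / 2) t).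
    assert (0 < s /\ s < d /\ s <= t) as (Hs1 & Hs2 & Hs3) by (unfold s, Rmin; destruct (Rle_dec _ _); lra).
    destruct (MVT_cont Y dY 0 s) as [k1 [Hk1 E1]]; [lra | intros; apply DY; lra | exact CY |].
    destruct (MVT_cont Y dY s t) as [k2 [Hk2 E2]]; [lra | intros; apply DY; lra | exact CY |].
    assert (dY k1 < 0).
    { assert (Hr : Rabs (dY k1 - dY 0) < - dY 0) by (apply Hd'; rewrite Rminus_0_r; apply Rabs_def1; lra). apply Rabs_def2 in Hr. lra. }
    specialize (NdY k2 ltac:(lra)).
    assert (Y 0 <= 0) by (unfold Y; specialize (HE 0); nra).
    nra. }
  intros t Ht. specialize (HY t Ht). unfold Y in HY. specialize (HE t). nra.
Qed.

(** The two cones force g < 0 for t > 0. From time 1 on, 1/g then increases at rate at least 1/3 and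
    would have to reach 0. The clock starts at 1 because g 0 may be 0. *)
Lemma riccati_blowup : a 0 = 0 -> g 0 <= 0 ->
  (forall c t, c = 3 / 2 \/ c = -3 / 2 -> 0 <= t -> 0 <= P t + c * Q t) ->
  (forall c, c = 3 / 2 \/ c = -3 / 2 -> 0 < P 0 + c * Q 0) -> False.
Proof.
  intros Ha0 Hg0 HPQ HPQ0.
  assert (H1 : forall t, 0 < t -> g t + 3 / 2 * a t < 0).
  { apply cone_invariant; [lra | rewrite Ha0; lra | intros; apply HPQ; auto | apply HPQ0; auto]. }
  assert (H2 : forall t, 0 < t -> g t + -3 / 2 * a t < 0).
  { apply cone_invariant; [lra | rewrite Ha0; lra | intros; apply HPQ; auto | apply HPQ0; auto]. }
  assert (G1 : forall t, 0 < t -> g t < 0) by (intros t Ht; specialize (H1 t Ht); specialize (H2 t Ht); lra).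
  (* The time at which the lower bound 1/g(1) + (T - 1)/3 equals 0. *)
  set (T := 1 - 3 * / g 1).
  assert (HT : 1 < T).
  { unfold T. specialize (G1 1 ltac:(lra)). pose proof (Rinv_lt_0_compat _ G1). lra. }
  destruct (MVT_gen (fun t => / g t) 1 T (fun t => - (- g t ^ 2 + 3 / 2 * a t ^ 2 - P t) / g t ^ 2)) as [k [Hk E]].
  - rewrite Rmin_left, Rmax_right by lra. intros t Ht. apply is_derive_inv; [apply Dg; lra|].
    specialize (G1 t ltac:(lra)). lra.
  - rewrite Rmin_left, Rmax_right by lra. intros t Ht. apply continuity_pt_filterlim.
    apply (cont_derive (fun t => / g t) t (- (- g t ^ 2 + 3 / 2 * a t ^ 2 - P t) / g t ^ 2)).
    apply is_derive_inv; [apply Dg; lra|]. specialize (G1 t ltac:(lra)). lra.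
  - rewrite Rmin_left, Rmax_right in Hk by lra.
    (* The product of the two cone inequalities gives (9/4) a^2 < g^2, hence (3/2) a^2 < (2/3) g^2;
       the sum of the two sign conditions gives P >= 0. *)
    assert (Hk' : / 3 <= - (- g k ^ 2 + 3 / 2 * a k ^ 2 - P k) / g k ^ 2).
    { specialize (H1 k ltac:(lra)). specialize (H2 k ltac:(lra)). specialize (G1 k ltac:(lra)).
      pose proof (HPQ (3/2) k ltac:(auto) ltac:(lra)). pose proof (HPQ (-3/2) k ltac:(auto) ltac:(lra)).
      assert (0 < g k ^ 2) by nra. apply Rle_div_r; [assumption|].
      assert (0 < (- g k - 3 / 2 * a k) * (- g k + 3 / 2 * a k)) by (apply Rmult_lt_0_compat; lra). nra. }
    pose proof (Rinv_lt_0_compat _ (G1 T ltac:(lra))).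
    assert (/ 3 * (T - 1) <= / g T - / g 1) by (rewrite E; apply Rmult_le_compat_r; lra).
    unfold T in *. lra.
Qed.
End Riccati.

(** * Global flow of a field bounded and Lipschitz in space on each [0, T] *)

Section Picard.
Variables (V : R -> R -> R) (x0 : R).
Hypothesis HV : forall q, (forall t, continuous q t) -> forall t, continuous (fun t => V t (q t)) t.
Hypothesis HL : forall T, 0 < T -> exists L, 0 < L /\ forall t x y, 0 <= t <= T -> Rabs (V t x - V t y) <= L * Rabs (x - y).
Hypothesis HM : forall T, 0 < T -> exists M, 0 < M /\ forall t x, 0 <= t <= T -> Rabs (V t x) <= M.

(** [HV] states continuity of [V] along continuous curves, which is what makes each integrand here
    continuous. *)
Fixpoint picard (n : nat) (t : R) : R :=
  match n with O => x0 | S n => x0 + RInt (fun s => V s (picard n s)) 0 t end.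

Lemma cont_picard n t : continuous (picard n) t.
Proof.
  revert t. induction n as [|n IH]; intros t; [apply continuous_const|]. simpl. apply cont_plus; [cont|].
  apply (cont_derive (fun t => RInt (fun s => V s (picard n s)) 0 t) t (V t (picard n t))).
  apply (is_derive_RInt_cont (fun s => V s (picard n s))). apply (HV (picard n)). exact IH.
Qed.

Lemma cont_V_picard n t : continuous (fun s => V s (picard n s)) t.
Proof. apply HV. apply cont_picard. Qed.

(* The weight exp (2 L t) makes the Picard map a contraction of ratio 1/2. *)
Lemma picard_step T : 0 < T -> exists K, 0 < K /\ forall n t, 0 <= t <= T -> Rabs (picard (S n) t - picard n t) <= K * (/ 2) ^ n.
Proof.
  intros HT. destruct (HL T HT) as [L [HL0 HL1]]. destruct (HM T HT) as [M [HM0 HM1]].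
  assert (H : forall n t, 0 <= t <= T -> Rabs (picard (S n) t - picard n t) <= M / L * (/ 2) ^ n * exp (2 * L * t)).
  { induction n as [|n IH]; intros t Ht.
    - simpl picard. rewrite Rplus_minus_l.
      apply Rle_trans with ((t - 0) * M).
      + apply abs_RInt_le_const; [lra | apply ex_RInt_cont; apply (cont_V_picard 0) | intros; apply HM1; lra].
      + pose proof (exp_ineq1_le (2 * L * t)). simpl pow.
        apply Rle_trans with (M / L * (L * t)); [right; field; lra|]. rewrite Rmult_1_r.
        apply Rmult_le_compat_l; [left; apply Rdiv_lt_0_compat; lra | nra].
    - change (picard (S (S n)) t) with (x0 + RInt (fun s => V s (picard (S n) s)) 0 t).
      change (picard (S n) t) with (x0 + RInt (fun s => V s (picard n s)) 0 t).
      assert (E0 : forall A B, x0 + A - (x0 + B) = 1 * A + -1 * B) by (intros; ring). rewrite E0.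
      pose proof (cont_V_picard n) as C1. pose proof (cont_V_picard (S n)) as C2.
      rewrite <- RInt_lin by (apply ex_RInt_cont; assumption).
      set (D := M / L * (/ 2) ^ n).
      assert (HD : 0 <= D) by (apply Rmult_le_pos; [left; apply Rdiv_lt_0_compat; lra | apply pow_le; lra]).
      set (F := fun s => D / 2 * exp (2 * L * s)).
      assert (CF : forall s, continuous (fun s => L * (D * exp (2 * L * s))) s).
      { intros s. apply cont_mult; [cont|]. apply cont_mult; [cont|].
        apply (cont_comp (fun s => 2 * L * s) exp); [cont | apply continuous_exp]. }
      assert (IF : is_RInt (fun s => L * (D * exp (2 * L * s))) 0 t (F t - F 0)).
      { apply (is_RInt_derive F); [|intros; apply CF]. intros s _. unfold F. auto_derive; [trivial|field]. }
      apply Rle_trans with (F t - F 0).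
      + apply (norm_RInt_le (fun s => 1 * V s (picard (S n) s) + -1 * V s (picard n s)) (fun s => L * (D * exp (2 * L * s))) 0 t); [lra | | | exact IF].
        * intros s Hs. change (Rabs (1 * V s (picard (S n) s) + -1 * V s (picard n s)) <= L * (D * exp (2 * L * s))).
          replace (1 * V s (picard (S n) s) + -1 * V s (picard n s)) with (V s (picard (S n) s) - V s (picard n s)) by ring.
          eapply Rle_trans; [apply HL1; lra|]. apply Rmult_le_compat_l; [lra|]. apply IH. lra.
        * apply RInt_correct_R, ex_RInt_cont. intros; cont.
      + unfold F. rewrite Rmult_0_r, exp_0. rewrite <- tech_pow_Rmult. replace (M / L * (/ 2 * (/ 2) ^ n)) with (D / 2) by (unfold D; field; lra). lra. }
  exists (M / L * exp (2 * L * T)). split; [apply Rmult_lt_0_compat; [apply Rdiv_lt_0_compat; lra | apply exp_pos]|].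
  intros n t Ht. eapply Rle_trans; [apply H; exact Ht|].
  rewrite (Rmult_assoc _ (exp _)), (Rmult_comm (exp _)), <- Rmult_assoc.
  apply Rmult_le_compat_l; [apply Rmult_le_pos; [left; apply Rdiv_lt_0_compat; lra | apply pow_le; lra]|].
  destruct (Req_dec t T) as [->|]; [lra|]. left. apply exp_increasing. apply Rmult_lt_compat_l; lra.
Qed.

Lemma picard_cauchy T : 0 < T -> exists K, 0 < K /\ forall n m t, 0 <= t <= T -> Rabs (picard (n + m) t - picard n t) <= K * (/ 2) ^ n.
Proof.
  intros HT. destruct (picard_step T HT) as [K [HK H]]. exists (2 * K). split; [lra|].
  intros n m t Ht.
  (* The exact partial geometric sum is kept so that the induction on [m] closes. *)
  assert (Rabs (picard (n + m) t - picard n t) <= 2 * K * ((/ 2) ^ n - (/ 2) ^ (n + m))).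
  { induction m as [|m IH].
    - rewrite Nat.add_0_r, Rminus_diag, Rminus_diag, Rabs_R0. lra.
    - rewrite Nat.add_succ_r. specialize (H (n + m)%nat t Ht).
      replace (picard (S (n + m)) t - picard n t) with ((picard (S (n + m)) t - picard (n + m) t) + (picard (n + m) t - picard n t)) by ring.
      eapply Rle_trans; [apply Rabs_triang|]. simpl pow. lra. }
  assert (0 < (/ 2) ^ (n + m)) by (apply pow_lt; lra). nra.
Qed.

(** Clamping the time freezes the curve at its initial value for t < 0, so that it is continuous on
    all of R. *)
Definition flow (t : R) : R := real (Lim_seq (fun n => picard n (Rmax 0 t))).

Lemma pow_half_small K eps : 0 < K -> 0 < eps -> exists N, forall n, (N <= n)%nat -> K * (/ 2) ^ n <= eps.
Proof.
  intros HK He. destruct (pow_lt_1_zero (/ 2) ltac:(rewrite Rabs_right; lra) (eps / K)) as [N HN]; [apply Rdiv_lt_0_compat; lra|].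
  exists N. intros n Hn. specialize (HN n Hn). rewrite Rabs_right in HN by (apply Rle_ge, pow_le; lra).
  apply Rlt_le. apply (Rmult_lt_compat_l K) in HN; [|exact HK]. replace (K * (eps / K)) with eps in HN by (field; lra). exact HN.
Qed.

Lemma flow_lim T : 0 < T -> exists K, 0 < K /\ forall n t, 0 <= t <= T -> Rabs (flow t - picard n t) <= K * (/ 2) ^ n.
Proof.
  intros HT. destruct (picard_cauchy T HT) as [K [HK H]]. exists K. split; [exact HK|].
  intros n t Ht. unfold flow. rewrite Rmax_right by lra.
  assert (EL : ex_finite_lim_seq (fun n => picard n t)).
  { apply ex_lim_seq_cauchy_corr. intros eps. destruct (pow_half_small K (eps / 4)) as [N HN]; [exact HK | destruct eps; simpl; lra|].
    exists N. intros i j Hi Hj.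
    pose proof (H N (i - N)%nat t Ht) as A. pose proof (H N (j - N)%nat t Ht) as B.
    replace (N + (i - N))%nat with i in A by lia. replace (N + (j - N))%nat with j in B by lia.
    specialize (HN N (Nat.le_refl N)). apply Rabs_le_between in A, B.
    pose proof (cond_pos eps). apply Rabs_def1; lra. }
  destruct EL as [l Hl]. rewrite (is_lim_seq_unique _ _ Hl). simpl.
  apply (is_lim_seq_incr_n _ n) in Hl.
  assert (B1 : Rbar_le l (picard n t + K * (/ 2) ^ n)).
  { apply (is_lim_seq_le (fun m => picard (m + n) t) (fun _ => picard n t + K * (/ 2) ^ n) l _); [|exact Hl|apply is_lim_seq_const].
    intros m. specialize (H n m t Ht). rewrite Nat.add_comm. apply Rabs_le_between in H. lra. }
  assert (B2 : Rbar_le (picard n t - K * (/ 2) ^ n) l).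
  { apply (is_lim_seq_le (fun _ => picard n t - K * (/ 2) ^ n) (fun m => picard (m + n) t) _ l); [|apply is_lim_seq_const|exact Hl].
    intros m. specialize (H n m t Ht). rewrite Nat.add_comm. apply Rabs_le_between in H. lra. }
  simpl in B1, B2. apply Rabs_le. lra.
Qed.

Lemma cont_flow t : continuous flow t.
Proof.
  (* The uniform estimates hold for nonnegative times; since the clamp is idempotent, all arguments
     may be taken in [0, T]. *)
  apply (continuous_ext (fun t => flow (Rmax 0 t))).
  { intros s. unfold flow. now rewrite (Rmax_right 0 (Rmax 0 s)) by apply Rmax_l. }
  apply cont_eps. intros eps He. set (T := Rabs t + 1). assert (HT : 0 < T) by (unfold T; pose proof (Rabs_pos t); lra).
  destruct (flow_lim T HT) as [K [HK H]].
  destruct (pow_half_small K (eps / 4)) as [N HN]; [exact HK | lra|]. specialize (HN N (Nat.le_refl N)).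
  assert (C : continuous (fun t => picard N (Rmax 0 t)) t).
  { apply (cont_comp (fun t => Rmax 0 t) (picard N)); [|apply cont_picard].
    apply (continuous_ext (fun t => (t + Rabs t) * / 2)).
    - intros s. unfold Rmax, Rabs. destruct (Rle_dec 0 s), (Rcase_abs s); lra.
    - apply cont_mult; [|cont]. apply cont_plus; [cont|]. apply continuous_Rabs. }
  destruct (proj1 (cont_eps _ t) C (eps / 4)) as [d [Hd Hd']]; [lra|].
  exists (Rmin d 1). split; [apply Rmin_pos; lra|]. intros s Hs.
  assert (Rabs (s - t) < d /\ Rabs (s - t) < 1) as [Hs1 Hs2].
  { split; eapply Rlt_le_trans; [exact Hs | apply Rmin_l | exact Hs | apply Rmin_r]. }
  specialize (Hd' s Hs1).
  assert (A1 : 0 <= Rmax 0 s <= T).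
  { split; [apply Rmax_l|]. apply Rmax_lub; [lra|]. unfold T. apply Rabs_def2 in Hs2. pose proof (Rle_abs t). lra. }
  assert (A2 : 0 <= Rmax 0 t <= T).
  { split; [apply Rmax_l|]. apply Rmax_lub; [lra|]. unfold T. pose proof (Rle_abs t). lra. }
  pose proof (H N _ A1) as B1. pose proof (H N _ A2) as B2.
  apply Rabs_le_between in B1, B2. apply Rabs_def2 in Hd'. apply Rabs_def1; lra.
Qed.

Lemma flow_integral t : 0 <= t -> flow t = x0 + RInt (fun s => V s (flow s)) 0 t.
Proof.
  intros Ht. apply Req_eps. intros eps He. set (T := t + 1).
  destruct (flow_lim T ltac:(unfold T; lra)) as [K [HK H]].
  destruct (HL T ltac:(unfold T; lra)) as [L [HL0 HL1]].
  (* The iterate contributes an error of at most [e] and the integrals at most t L e, together eps /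
     2. *)
  destruct (pow_half_small K (eps / (2 + 2 * t * L))) as [N HN]; [exact HK | apply Rdiv_lt_0_compat; nra|].
  set (e := eps / (2 + 2 * t * L)) in *.
  pose proof (HN N (Nat.le_refl N)) as HN1. pose proof (HN (S N) ltac:(lia)) as HN2.
  pose proof (H (S N) t ltac:(unfold T; lra)) as A. simpl picard in A.
  pose proof (cont_V_picard N) as C1. pose proof (HV flow cont_flow) as C2.
  assert (B : Rabs (RInt (fun s => V s (picard N s)) 0 t - RInt (fun s => V s (flow s)) 0 t) <= (t - 0) * (L * e)).
  { assert (E0 : forall A B, A - B = 1 * A + -1 * B) by (intros; ring). rewrite E0.
    rewrite <- RInt_lin by (apply ex_RInt_cont; assumption).
    apply abs_RInt_le_const; [lra | apply ex_RInt_cont; intros; cont|].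
    intros s Hs. replace (1 * V s (picard N s) + -1 * V s (flow s)) with (- (V s (flow s) - V s (picard N s))) by ring.
    rewrite Rabs_Ropp. eapply Rle_trans; [apply HL1; unfold T; lra|]. apply Rmult_le_compat_l; [lra|].
    eapply Rle_trans; [apply H; unfold T; lra | exact HN1]. }
  assert (Ee : e * (2 + 2 * t * L) = eps) by (unfold e; field; nra).
  apply Rabs_le_between in A, B. assert (0 <= t * (L * e)).
  { apply Rmult_le_pos; [lra|]. apply Rmult_le_pos; [lra|]. unfold e. left. apply Rdiv_lt_0_compat; nra. }
  apply Rabs_le. nra.
Qed.

Theorem global_flow : exists q, q 0 = x0 /\ (forall t, continuous q t) /\ forall t, 0 < t -> is_derive q t (V t (q t)).
Proof.
  exists flow. split; [|split].
  - rewrite flow_integral by lra. rewrite RInt_point. apply Rplus_0_r.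
  - exact cont_flow.
  - intros t Ht. apply (is_derive_ext_loc (fun t => x0 + RInt (fun s => V s (flow s)) 0 t)).
    + exists (mkposreal t Ht). intros y Hy. change (Rabs (y - t) < t) in Hy. apply Rabs_def2 in Hy. symmetry. apply flow_integral. lra.
    + rewrite <- (Rplus_0_l (V t (flow t))). apply (is_derive_plus (fun _ => x0)).
      * exact (@is_derive_const R_AbsRing R_NormedModule x0 t).
      * apply (is_derive_RInt_cont (fun s => V s (flow s))). apply HV. exact cont_flow.
Qed.
End Picard.

(** * Classical solutions *)

Lemma is_derive_eps (f : R -> R) (t l : R) :
  (forall eps, 0 < eps -> exists d, 0 < d /\ forall s, Rabs (s - t) < d -> Rabs (f s - f t - (s - t) * l) <= eps * Rabs (s - t)) ->
  is_derive f t l.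
Proof.
  intros H. apply is_derive_Reals. intros eps He. destruct (H (eps / 2)) as [d [Hd Hd']]; [lra|].
  exists (mkposreal d Hd). intros h Hh Hhd. simpl in Hhd. specialize (Hd' (t + h)).
  replace (t + h - t) with h in Hd' by ring. specialize (Hd' Hhd).
  replace ((f (t + h) - f t) / h - l) with ((f (t + h) - f t - h * l) / h) by (field; assumption).
  unfold Rdiv. rewrite Rabs_mult, Rabs_inv. apply Rabs_pos_lt in Hh.
  apply Rle_lt_trans with (eps / 2 * Rabs h * / Rabs h).
  - apply Rmult_le_compat_r; [left; now apply Rinv_0_lt_compat | exact Hd'].
  - rewrite Rmult_assoc, Rinv_r by lra. lra.
Qed.

Lemma is_derive_pos_sign (f : R -> R) x l : is_derive f x l -> 0 < l ->
  exists d, 0 < d /\ forall h, 0 < h < d -> f x < f (x + h) /\ f (x - h) < f x.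
Proof.
  intros H Hl. apply is_derive_Reals in H. destruct (H l Hl) as [d Hd]. exists d. split; [apply cond_pos|].
  intros h Hh. pose proof (Hd h ltac:(lra) ltac:(rewrite Rabs_right; lra)) as A.
  pose proof (Hd (- h) ltac:(lra) ltac:(rewrite Rabs_left; lra)) as B.
  apply Rabs_def2 in A, B. fold (x - h) in B.
  destruct A as [_ A], B as [_ B].
  assert (0 < (f (x + h) - f x) / h) by lra. assert (0 < (f (x - h) - f x) / - h) by lra.
  split.
  - apply Rmult_lt_compat_r with (r := h) in H0; [|lra]. replace ((f (x + h) - f x) / h * h) with (f (x + h) - f x) in H0 by (field; lra). lra.
  - apply Rmult_lt_compat_r with (r := h) in H1; [|lra]. replace ((f (x - h) - f x) / - h * h) with (- (f (x - h) - f x)) in H1 by (field; lra). lra.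
Qed.

Lemma periodic1_derive (f f' : R -> R) : periodic1 f -> (forall x, is_derive f x (f' x)) -> periodic1 f'.
Proof.
  intros Hp Hd x.
  assert (D : is_derive (fun y => f (y + 1)) x (1 * f' (x + 1))).
  { apply (is_derive_comp f (fun y => y + 1)); [apply Hd|]. auto_derive; [trivial|reflexivity]. }
  apply (is_derive_ext _ f) in D; [|exact Hp].
  apply is_derive_unique in D. rewrite (is_derive_unique _ _ _ (Hd x)) in D. lra.
Qed.

(** If f' z > 0, then f < 0 at some [w] just to the left of z + 1. The last point of [z, w] with f
    >= 0 is a zero followed by negative values, so the derivative there is not positive. *)
Lemma periodic_zero_nonincreasing (f f' : R -> R) z : periodic1 f -> (forall x, is_derive f x (f' x)) -> f z = 0 ->
  exists x, f x = 0 /\ f' x <= 0.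
Proof.
  intros Hp Hd Hz. destruct (Rle_dec (f' z) 0) as [|Hz']; [now exists z|].
  assert (Cf : forall x, continuous f x) by (intros x; exact (cont_derive _ _ _ (Hd x))).
  assert (Hw : exists w, z < w /\ f w < 0).
  { destruct (is_derive_pos_sign f (z + 1) (f' (z + 1)) (Hd _)) as [d [Hd0 H]].
    { rewrite (periodic1_derive f f' Hp Hd). lra. }
    set (h := Rmin (d / 2) (1 / 2)). assert (0 < h /\ h < d /\ h < 1) as (? & ? & ?) by (unfold h, Rmin; destruct (Rle_dec _ _); lra).
    exists (z + 1 - h). split; [lra|]. rewrite <- Hz, <- (Hp z). apply H. lra. }
  destruct Hw as [w [Hzw Hw]].
  set (E := fun x => z <= x <= w /\ 0 <= f x).
  destruct (completeness E) as [m [Hm1 Hm2]].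
  { exists w. intros x [Hx _]. lra. }
  { exists z. split; lra. }
  assert (Hzm : z <= m) by (apply Hm1; split; lra).
  assert (Hmw : m <= w) by (apply Hm2; intros x [Hx _]; lra).
  assert (Hm0 : 0 <= f m).
  { apply Rnot_lt_le. intros Hlt. destruct (proj1 (cont_eps f m) (Cf m) (- f m)) as [d [Hd0 H]]; [lra|].
    assert (m <= m - d / 2); [|lra]. apply Hm2. intros x [Hx Hfx]. apply Rnot_lt_le. intros Hlt2.
    assert (x <= m) by (apply Hm1; split; assumption).
    assert (Hr : Rabs (f x - f m) < - f m) by (apply H; apply Rabs_def1; lra). apply Rabs_def2 in Hr. lra. }
  assert (Hmw' : m < w) by (destruct (Req_dec m w) as [->|]; lra).
  assert (Hright : forall x, m < x <= w -> f x < 0).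
  { intros x Hx. apply Rnot_le_lt. intros Hge. assert (x <= m); [|lra]. apply Hm1. split; lra. }
  assert (Hm0' : f m <= 0).
  { apply Rnot_lt_le. intros Hlt. destruct (proj1 (cont_eps f m) (Cf m) (f m)) as [d [Hd0 H]]; [lra|].
    set (x := Rmin w (m + d / 2)). assert (m < x /\ x <= w /\ x < m + d) as (? & ? & ?) by (unfold x, Rmin; destruct (Rle_dec _ _); lra).
    assert (Hr : Rabs (f x - f m) < f m) by (apply H; apply Rabs_def1; lra). apply Rabs_def2 in Hr.
    specialize (Hright x ltac:(lra)). lra. }
  exists m. split; [lra|]. apply Rnot_lt_le. intros Hlt.
  destruct (is_derive_pos_sign f m (f' m) (Hd _) Hlt) as [d [Hd0 H]].
  set (h := Rmin (d / 2) (w - m)). assert (0 < h /\ h < d /\ h <= w - m) as (? & ? & ?) by (unfold h, Rmin; destruct (Rle_dec _ _); lra).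
  specialize (H h ltac:(lra)). specialize (Hright (m + h) ltac:(lra)). lra.
Qed.

Lemma mean_zero_vanishes (f : R -> R) : (forall x, continuous f x) -> RInt f 0 1 = 0 -> exists x, f x = 0.
Proof.
  intros Hf H. destruct (MVT_cont (fun x => RInt f 0 x) f 0 1) as [c [_ E]]; [lra | | |].
  - intros t _. now apply is_derive_RInt_cont.
  - intros t. apply (cont_derive (fun x => RInt f 0 x) t (f t)). now apply is_derive_RInt_cont.
  - rewrite H, RInt_point in E. exists c. change zero with 0 in E. lra.
Qed.

(** Continuity in time for the sup norm in space, one-sided at t = 0. *)
Definition unif (f : R -> R -> R) : Prop := forall t, 0 <= t -> forall eps, 0 < eps -> exists d, 0 < d /\
  forall t', 0 <= t' -> Rabs (t' - t) < d -> forall x, Rabs (f t' x - f t x) <= eps.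

Lemma unif_joint f : unif f -> (forall t, 0 <= t -> forall x, continuous (f t) x) -> forall t x eps, 0 <= t -> 0 < eps ->
  exists d, 0 < d /\ forall t' x', 0 <= t' -> Rabs (t' - t) < d -> Rabs (x' - x) < d -> Rabs (f t' x' - f t x) < eps.
Proof.
  intros Hu Hc t x eps Ht He. destruct (Hu t Ht (eps / 2)) as [d1 [Hd1 H1]]; [lra|].
  destruct (proj1 (cont_eps _ x) (Hc t Ht x) (eps / 2)) as [d2 [Hd2 H2]]; [lra|].
  exists (Rmin d1 d2). split; [now apply Rmin_pos|]. intros t' x' Ht' A B.
  specialize (H1 t' Ht' (Rlt_le_trans _ _ _ A (Rmin_l _ _)) x'). specialize (H2 x' (Rlt_le_trans _ _ _ B (Rmin_r _ _))).
  apply Rabs_le_between in H1. apply Rabs_def2 in H2. apply Rabs_def1; lra.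
Qed.

Lemma Rmax0_lip s t : Rabs (Rmax 0 s - Rmax 0 t) <= Rabs (s - t).
Proof. unfold Rmax, Rabs. destruct (Rle_dec 0 s), (Rle_dec 0 t); repeat destruct (Rcase_abs _); lra. Qed.

(** The clamp extends the composite to negative times, so that the results on continuous functions
    on R apply. *)
Lemma unif_along f : unif f -> (forall t, 0 <= t -> forall x, continuous (f t) x) -> forall q, (forall t, continuous q t) ->
  forall t, continuous (fun t => f (Rmax 0 t) (q t)) t.
Proof.
  intros Hu Hc q Hq t. apply cont_eps. intros eps He.
  destruct (unif_joint f Hu Hc (Rmax 0 t) (q t) eps (Rmax_l _ _) He) as [d [Hd H]].
  destruct (proj1 (cont_eps q t) (Hq t) d Hd) as [d2 [Hd2 H2]].
  exists (Rmin d d2). split; [now apply Rmin_pos|]. intros s Hs. apply H; [apply Rmax_l | |].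
  - eapply Rle_lt_trans; [apply Rmax0_lip|]. eapply Rlt_le_trans; [exact Hs | apply Rmin_l].
  - apply H2. eapply Rlt_le_trans; [exact Hs | apply Rmin_r].
Qed.

(** Compactness of [0, T] through a supremum of admissible end times; in space, periodicity reduces
    boundedness to one period. *)
Lemma unif_bounded f : unif f -> (forall t, 0 <= t -> forall x, continuous (f t) x) -> (forall t, 0 <= t -> periodic1 (f t)) ->
  forall T, 0 < T -> exists M, 0 < M /\ forall t x, 0 <= t <= T -> Rabs (f t x) <= M.
Proof.
  intros Hu Hc Hp T HT.
  set (E := fun s => 0 <= s <= T /\ exists M, 0 < M /\ forall t x, 0 <= t <= s -> Rabs (f t x) <= M).
  assert (Hloc : forall t, 0 <= t -> exists d M, 0 < d /\ 0 < M /\ forall t' x, 0 <= t' -> Rabs (t' - t) < d -> Rabs (f t' x) <= M).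
  { intros t Ht. destruct (Hu t Ht 1 Rlt_0_1) as [d [Hd H]]. destruct (periodic1_bounded (f t) (Hp t Ht) (Hc t Ht)) as [M [HM HM']].
    exists d, (M + 1). split; [exact Hd|]. split; [lra|]. intros t' x Ht' A. specialize (H t' Ht' A x). specialize (HM' x).
    replace (f t' x) with (f t x + (f t' x - f t x)) by ring. eapply Rle_trans; [apply Rabs_triang|]. lra. }
  destruct (completeness E) as [m [Hm1 Hm2]].
  { exists T. intros s [Hs _]. lra. }
  { exists 0. split; [lra|]. destruct (Hloc 0 (Rle_refl 0)) as (d & M & Hd & HM & H). exists M. split; [exact HM|].
    intros t x Ht. apply H; [lra|]. replace t with 0 by lra. rewrite Rminus_diag, Rabs_R0. exact Hd. }
  assert (H0m : 0 <= m).
  { apply Hm1. split; [lra|]. destruct (Hloc 0 (Rle_refl 0)) as (d & M & Hd & HM & H). exists M. split; [exact HM|].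
    intros t x Ht. apply H; [lra|]. replace t with 0 by lra. rewrite Rminus_diag, Rabs_R0. exact Hd. }
  assert (HmT : m <= T) by (apply Hm2; intros s [Hs _]; lra).
  destruct (Hloc m H0m) as (d & M & Hd & HM & H).
  assert (Hs : exists s, E s /\ m - d < s).
  { apply NNPP. intros Hn. assert (m <= m - d); [|lra]. apply Hm2. intros s Hs. apply Rnot_lt_le. intros Hlt. apply Hn. now exists s. }
  destruct Hs as [s [[Hs [M' [HM' H']]] Hsd]].
  (* The local bound near [m] extends admissibility to [r], which would exceed the supremum [m]
     unless r = T. *)
  set (r := Rmin T (m + d / 2)). assert (r <= T /\ r <= m + d / 2 /\ (r = T \/ r = m + d / 2) /\ 0 <= r) as (Hr1 & Hr2 & Hr3 & Hr4).
  { unfold r, Rmin. destruct (Rle_dec _ _); lra. }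
  assert (Er : E r).
  { split; [lra|]. exists (M + M'). split; [lra|]. intros t x Ht. destruct (Rle_dec t s).
    - specialize (H' t x ltac:(lra)). lra.
    - specialize (H t x ltac:(lra)). assert (s <= m) by (apply Hm1; split; [lra | exists M'; auto]).
      specialize (H ltac:(apply Rabs_def1; lra)). lra. }
  pose proof (Hm1 r Er). destruct Hr3 as [Hr3|Hr3]; [|lra]. rewrite Hr3 in Er. apply Er.
Qed.

(** The regularity that survives the embeddings, for u = v + kappa: C^1 in space with [u] and [ux]
    continuous in time for the sup norm, and a time derivative [ut] taken in the sup norm at t > 0.
    The transport speed u - kappa is the original v. *)
Record classical (kappa : R) (u ux ut : R -> R -> R) : Prop := {
  cl_per : forall t, 0 <= t -> periodic1 (u t);
  cl_ux : forall t, 0 <= t -> forall x, is_derive (u t) x (ux t x);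
  cl_ux_cont : forall t, 0 <= t -> forall x, continuous (ux t) x;
  cl_unif : unif u;
  cl_ux_unif : unif ux;
  cl_ut : forall t, 0 < t -> forall eps, 0 < eps -> exists d, 0 < d /\
    forall t', 0 <= t' -> Rabs (t' - t) < d -> forall x, Rabs (u t' x - u t x - (t' - t) * ut t x) <= eps * Rabs (t' - t);
  cl_pde : forall t, 0 < t -> forall x, ut t x + (u t x - kappa) * ux t x + Qk (fun y => 3 / 2 * u t y ^ 2) x = 0
}.

(** Lets the blow-up argument, written for initial time 0, start at any time. *)
Lemma classical_shift kappa u ux ut t0 : 0 <= t0 -> classical kappa u ux ut ->
  classical kappa (fun t => u (t0 + t)) (fun t => ux (t0 + t)) (fun t => ut (t0 + t)).
Proof.
  intros H0 C. destruct C as [C1 C2 C3 C4 C5 C6 C7].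
  assert (U : forall f, unif f -> unif (fun t => f (t0 + t))).
  { intros f Hf t Ht eps He. destruct (Hf (t0 + t) ltac:(lra) eps He) as [d [Hd H]]. exists d. split; [exact Hd|].
    intros t' Ht' A. apply H; [lra|]. replace (t0 + t' - (t0 + t)) with (t' - t) by ring. exact A. }
  split; try (intros; apply C1 || apply C2 || apply C3; lra); try (apply U; assumption).
  - intros t Ht eps He. destruct (C6 (t0 + t) ltac:(lra) eps He) as [d [Hd H]]. exists d. split; [exact Hd|].
    intros t' Ht' A x. specialize (H (t0 + t') ltac:(lra)). replace (t0 + t' - (t0 + t)) with (t' - t) in H by ring. now apply H.
  - intros t Ht x. apply C7. lra.
Qed.

(** * Properties of a fixed classical solution *)

Section Classical.
Variables (kappa : R) (u ux ut : R -> R -> R).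
Hypothesis C : classical kappa u ux ut.

Lemma cl_cont t : 0 <= t -> forall x, continuous (u t) x.
Proof. intros Ht x. exact (cont_derive _ _ _ (cl_ux _ _ _ _ C t Ht x)). Qed.

Lemma cl_ux_per t : 0 <= t -> periodic1 (ux t).
Proof. intros Ht. apply (periodic1_derive (u t)); [now apply (cl_per _ _ _ _ C) | now apply (cl_ux _ _ _ _ C)]. Qed.

Definition sq (t y : R) : R := 3 / 2 * u t y ^ 2.

Lemma sq_cont t : 0 <= t -> forall x, continuous (sq t) x.
Proof. intros Ht x. pose proof (cl_cont t Ht). unfold sq. cont. Qed.

Lemma sq_per t : 0 <= t -> periodic1 (sq t).
Proof. intros Ht x. unfold sq. now rewrite (cl_per _ _ _ _ C t Ht). Qed.

Lemma sq_nonneg t y : 0 <= sq t y.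
Proof. unfold sq. pose proof (pow2_ge_0 (u t y)). lra. Qed.

Lemma sq_unif : unif sq.
Proof.
  intros t Ht eps He. destruct (periodic1_bounded (u t) (cl_per _ _ _ _ C t Ht) (cl_cont t Ht)) as [M [HM HM']].
  (* The difference of squares is delta (delta + 2 u) with |delta| <= e <= 1, hence at most e (1 + 2
     M). *)
  set (e := Rmin 1 (eps / (3 / 2 * (1 + 2 * M)))).
  assert (0 < eps / (3 / 2 * (1 + 2 * M))) by (apply Rdiv_lt_0_compat; lra).
  assert (He' : 0 < e) by (apply Rmin_pos; lra).
  destruct (cl_unif _ _ _ _ C t Ht e He') as [d [Hd H1]]. exists d. split; [exact Hd|].
  intros t' Ht' A x. specialize (H1 t' Ht' A x). specialize (HM' x). unfold sq.
  assert (e <= 1) by apply Rmin_l. assert (e <= eps / (3 / 2 * (1 + 2 * M))) by apply Rmin_r.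
  replace (3 / 2 * u t' x ^ 2 - 3 / 2 * u t x ^ 2) with (3 / 2 * ((u t' x - u t x) * ((u t' x - u t x) + 2 * u t x))) by ring.
  rewrite !Rabs_mult, (Rabs_right (3 / 2)) by lra.
  apply Rle_trans with (3 / 2 * (eps / (3 / 2 * (1 + 2 * M)) * (1 + 2 * M))); [|right; field; lra].
  apply Rmult_le_compat_l; [lra|]. apply Rmult_le_compat; try apply Rabs_pos; [lra|].
  eapply Rle_trans; [apply Rabs_triang|]. rewrite Rabs_mult, (Rabs_right 2) by lra. lra.
Qed.

Lemma PQ_unif : unif (fun t => Pk (sq t)) /\ unif (fun t => Qk (sq t)).
Proof.
  pose proof Sh_pos.
  assert (U : forall t, 0 <= t -> forall eps, 0 < eps -> exists d, 0 < d /\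
    forall t', 0 <= t' -> Rabs (t' - t) < d -> forall x, Rabs (Pk (sq t') x - Pk (sq t) x) <= eps /\ Rabs (Qk (sq t') x - Qk (sq t) x) <= eps).
  { intros t Ht eps He. assert (Hm : 0 < eps * Sh / 3) by (apply Rdiv_lt_0_compat; nra).
    destruct (sq_unif t Ht (eps * Sh / 3) Hm) as [d [Hd H1]]. exists d. split; [exact Hd|].
    intros t' Ht' A x. specialize (H1 t' Ht' A). pose proof (sq_cont t Ht) as c1. pose proof (sq_cont t' Ht') as c2.
    destruct (Pk_le (fun y => 1 * sq t' y + -1 * sq t y) (eps * Sh / 3) x) as [B1 B2]; [intros; cont | lra | |].
    { intros y. replace (1 * sq t' y + -1 * sq t y) with (sq t' y - sq t y) by ring. apply H1. }
    rewrite Pk_lin in B1 by assumption. rewrite Qk_lin in B2 by assumption.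
    replace (3 / Sh * (eps * Sh / 3)) with eps in B1, B2 by (field; lra).
    split; [replace (Pk (sq t') x - Pk (sq t) x) with (1 * Pk (sq t') x + -1 * Pk (sq t) x) by ring; exact B1 |
      replace (Qk (sq t') x - Qk (sq t) x) with (1 * Qk (sq t') x + -1 * Qk (sq t) x) by ring; exact B2]. }
  split; intros t Ht eps He; destruct (U t Ht eps He) as [d [Hd H1]]; exists d; (split; [exact Hd|]); intros t' Ht' A x; now apply (H1 t' Ht' A).
Qed.

Lemma Pk_sq_cont t : 0 <= t -> forall x, continuous (Pk (sq t)) x.
Proof. intros Ht x. apply (cont_derive _ x (Qk (sq t) x)). apply Pk_derive; [now apply sq_per | now apply sq_cont]. Qed.

Lemma Qk_sq_derive t : 0 <= t -> forall x, is_derive (Qk (sq t)) x (Pk (sq t) x - sq t x).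
Proof. intros Ht x. apply Qk_derive; [now apply sq_per | now apply sq_cont]. Qed.

Lemma Qk_sq_cont t : 0 <= t -> forall x, continuous (Qk (sq t)) x.
Proof. intros Ht x. exact (cont_derive _ _ _ (Qk_sq_derive t Ht x)). Qed.

Lemma cl_ut_eq t x : 0 < t -> ut t x = - ((u t x - kappa) * ux t x + Qk (sq t) x).
Proof. intros Ht. pose proof (cl_pde _ _ _ _ C t Ht x) as E. unfold sq. lra. Qed.

Lemma cl_ut_cont t : 0 < t -> forall x, continuous (ut t) x.
Proof.
  intros Ht x. pose proof (cl_cont t ltac:(lra)). pose proof (cl_ux_cont _ _ _ _ C t ltac:(lra)). pose proof (Qk_sq_cont t ltac:(lra)).
  apply (continuous_ext (fun x => - ((u t x - kappa) * ux t x + Qk (sq t) x))).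
  - intros y. symmetry. now apply cl_ut_eq.
  - cont.
Qed.

(** The equation is in divergence form: [ut] is the space derivative of the periodic function
    [F]. *)
Lemma mean_ut t : 0 < t -> RInt (ut t) 0 1 = 0.
Proof.
  intros Ht. assert (Ht' : 0 <= t) by lra. apply is_RInt_unique.
  set (F := fun x => - (u t x ^ 2 / 2 - kappa * u t x + Pk (sq t) x)).
  replace 0 with (F 1 - F 0) at 2.
  - apply (is_RInt_derive F); [|intros; now apply cl_ut_cont]. intros x _. rewrite cl_ut_eq by exact Ht.
    pose proof (cl_ux _ _ _ _ C t Ht' x) as D1. pose proof (Pk_derive (sq t) (sq_per t Ht') (sq_cont t Ht') x) as D2.
    unfold F. auto_derive.
    + split; [eexists; exact D1 | split; [eexists; exact D1 | split; [eexists; exact D2 | trivial]]].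
    + apply is_derive_unique in D1, D2.
      change (fun x => u t x) with (u t). change (fun x => Pk (sq t) x) with (Pk (sq t)).
      rewrite D1, D2. field.
  - unfold F. replace 1 with (0 + 1) by ring. rewrite (cl_per _ _ _ _ C t Ht'), (Pk_periodic (sq t) (sq_per t Ht') (sq_cont t Ht')). ring.
Qed.

(** [cl_ut] is uniform in x, which allows differentiation under the integral. *)
Lemma mean_conserved t : 0 <= t -> RInt (u t) 0 1 = RInt (u 0) 0 1.
Proof.
  intros Ht. destruct (MVT_cont (fun t => RInt (u (Rmax 0 t)) 0 1) (fun _ => 0) 0 t Ht) as [c [_ E]].
  - intros s Hs. apply is_derive_eps. intros eps He.
    destruct (cl_ut _ _ _ _ C s (proj1 Hs) eps He) as [d [Hd H1]]. exists (Rmin d s). split; [apply Rmin_pos; lra|].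
    intros r Hr. assert (A : Rabs (r - s) < d) by (eapply Rlt_le_trans; [exact Hr | apply Rmin_l]).
    assert (B : Rabs (r - s) < s) by (eapply Rlt_le_trans; [exact Hr | apply Rmin_r]). apply Rabs_def2 in B.
    rewrite !Rmax_right by lra.
    pose proof (cl_cont r ltac:(lra)) as c1. pose proof (cl_cont s ltac:(lra)) as c2. pose proof (cl_ut_cont s ltac:(lra)) as c3.
    assert (E0 : RInt (fun x => 1 * (1 * u r x + -1 * u s x) + - (r - s) * ut s x) 0 1 = RInt (u r) 0 1 - RInt (u s) 0 1 - (r - s) * 0).
    { rewrite RInt_lin, RInt_lin by (apply ex_RInt_cont; intros; cont). rewrite mean_ut by lra. toR. ring. }
    rewrite <- E0. replace (eps * Rabs (r - s)) with ((1 - 0) * (eps * Rabs (r - s))) by ring.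
    apply abs_RInt_le_const; [lra | apply ex_RInt_cont; intros; cont |].
    intros x _. replace (1 * (1 * u r x + -1 * u s x) + - (r - s) * ut s x) with (u r x - u s x - (r - s) * ut s x) by ring.
    apply H1; [lra | exact A].
  - intros s. apply cont_eps. intros eps He.
    destruct (cl_unif _ _ _ _ C (Rmax 0 s) (Rmax_l _ _) (eps / 2)) as [d [Hd H1]]; [lra|]. exists d. split; [exact Hd|].
    intros r Hr. pose proof (cl_cont (Rmax 0 r) (Rmax_l _ _)) as c1. pose proof (cl_cont (Rmax 0 s) (Rmax_l _ _)) as c2.
    assert (E0 : RInt (fun x => 1 * u (Rmax 0 r) x + -1 * u (Rmax 0 s) x) 0 1 = RInt (u (Rmax 0 r)) 0 1 - RInt (u (Rmax 0 s)) 0 1).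
    { rewrite RInt_lin by (apply ex_RInt_cont; intros; cont). toR. ring. }
    rewrite <- E0. apply Rle_lt_trans with ((1 - 0) * (eps / 2)); [|lra].
    apply abs_RInt_le_const; [lra | apply ex_RInt_cont; intros; cont |].
    intros x _. replace (1 * u (Rmax 0 r) x + -1 * u (Rmax 0 s) x) with (u (Rmax 0 r) x - u (Rmax 0 s) x) by ring.
    apply H1; [apply Rmax_l | eapply Rle_lt_trans; [apply Rmax0_lip | exact Hr]].
  - rewrite !Rmax_right in E by lra. lra.
Qed.

(** A chain rule without joint differentiability: the time increment is expanded at the moving point
    [q s], where the remainder is controlled because [cl_ut] is uniform in x, and what is left is a
    function of space at the fixed time [t]. *)
Lemma transport_derive (q : R -> R) t dq : 0 < t -> is_derive q t dq -> is_derive (fun s => u (Rmax 0 s) (q s)) t (ut t (q t) + ux t (q t) * dq).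
Proof.
  intros Ht Hq. assert (Ht' : 0 <= t) by lra.
  apply (is_derive_ext (fun s => (u (Rmax 0 s) (q s) - u t (q s) - (s - t) * ut t (q s)) + ((s - t) * ut t (q s) + u t (q s)))); [intros; toR; ring|].
  replace (ut t (q t) + ux t (q t) * dq) with (0 + (ut t (q t) + dq * ux t (q t))) by ring.
  apply (is_derive_plus (fun s => u (Rmax 0 s) (q s) - u t (q s) - (s - t) * ut t (q s)) (fun s => (s - t) * ut t (q s) + u t (q s)) t 0).
  - apply is_derive_eps. intros eps He. destruct (cl_ut _ _ _ _ C t Ht eps He) as [d [Hd H1]].
    exists (Rmin d t). split; [apply Rmin_pos; lra|]. intros r Hr.
    assert (A : Rabs (r - t) < d) by (eapply Rlt_le_trans; [exact Hr | apply Rmin_l]).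
    assert (B : Rabs (r - t) < t) by (eapply Rlt_le_trans; [exact Hr | apply Rmin_r]). apply Rabs_def2 in B.
    rewrite !Rmax_right by lra.
    match goal with |- Rabs ?X <= _ => replace X with (u r (q r) - u t (q r) - (r - t) * ut t (q r)) by ring end.
    apply H1; [lra | exact A].
  - apply (is_derive_plus (fun s => (s - t) * ut t (q s)) (fun s => u t (q s))).
    + apply is_derive_eps. intros eps He.
      assert (Cc : continuous (fun s => ut t (q s)) t) by (apply (cont_comp q (ut t)); [exact (cont_derive _ _ _ Hq) | now apply cl_ut_cont]).
      destruct (proj1 (cont_eps _ t) Cc eps He) as [d [Hd H1]]. exists d. split; [exact Hd|]. intros r Hr. specialize (H1 r Hr).
      replace ((r - t) * ut t (q r) - (t - t) * ut t (q t) - (r - t) * ut t (q t)) with ((ut t (q r) - ut t (q t)) * (r - t)) by ring.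
      rewrite Rabs_mult. apply Rmult_le_compat_r; [apply Rabs_pos | lra].
    + apply (is_derive_comp (u t) q); [now apply (cl_ux _ _ _ _ C) | exact Hq].
Qed.

(** * Evolution of the solution and its slope along a characteristic *)

Section Characteristic.
Variable q : R -> R.
Hypothesis q_cont : forall t, continuous q t.
Hypothesis q_flow : forall t, 0 < t -> is_derive q t (u (Rmax 0 t) (q t) - kappa).

(** The shifted curve q + h moves with the speed of q rather than its own; the mismatch produces the
    last term, which vanishes for h = 0. *)
Lemma along_derive h t : 0 < t -> is_derive (fun s => u (Rmax 0 s) (q s + h)) t (- Qk (sq t) (q t + h) - ux t (q t + h) * (u t (q t + h) - u t (q t))).
Proof.
  intros Ht.
  assert (D : is_derive (fun s => q s + h) t (u t (q t) - kappa)).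
  { rewrite <- (Rplus_0_r (u t (q t) - kappa)). apply (is_derive_plus q (fun _ => h)); [|exact (@is_derive_const R_AbsRing R_NormedModule h t)].
    rewrite <- (Rmax_right 0 t) at 2 by lra. now apply q_flow. }
  pose proof (transport_derive _ t _ Ht D) as D2.
  replace (- Qk (sq t) (q t + h) - ux t (q t + h) * (u t (q t + h) - u t (q t))) with (ut t (q t + h) + ux t (q t + h) * (u t (q t) - kappa)); [exact D2|].
  rewrite cl_ut_eq by exact Ht. ring.
Qed.

Definition dquot (h t : R) : R := (u (Rmax 0 t) (q t + h) - u (Rmax 0 t) (q t)) / h.

Lemma dquot_mean h t : 0 < h -> 0 <= t -> exists y, q t <= y <= q t + h /\ dquot h t = ux t y.
Proof.
  intros Hh Ht. destruct (MVT_cont (u t) (ux t) (q t) (q t + h)) as [y [Hy E]]; [lra | intros; now apply (cl_ux _ _ _ _ C) | now apply cl_cont |].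
  exists y. split; [exact Hy|]. unfold dquot. rewrite Rmax_right by lra. rewrite E. field. lra.
Qed.

(** The mean value theorem replaces the quotient of [Qk] by its derivative at [y1] and the quotient
    of u by [ux] at [y2]. Both points are within [h] of the characteristic, so the right side tends
    to the Riccati expression. *)
Lemma dquot_derive h t : 0 < h -> 0 < t -> exists y1 y2, q t <= y1 <= q t + h /\ q t <= y2 <= q t + h /\
  is_derive (dquot h) t (- (Pk (sq t) y1 - sq t y1) - ux t (q t + h) * ux t y2).
Proof.
  intros Hh Ht.
  destruct (MVT_cont (Qk (sq t)) (fun y => Pk (sq t) y - sq t y) (q t) (q t + h)) as [y1 [Hy1 E1]]; [lra | intros; apply Qk_sq_derive; lra | intros; apply Qk_sq_cont; lra |].
  destruct (dquot_mean h t Hh ltac:(lra)) as [y2 [Hy2 E2]].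
  exists y1, y2. split; [exact Hy1|]. split; [exact Hy2|].
  pose proof (along_derive h t Ht) as D1. pose proof (along_derive 0 t Ht) as D0.
  replace (- (Pk (sq t) y1 - sq t y1) - ux t (q t + h) * ux t y2) with
    (/ h * ((- Qk (sq t) (q t + h) - ux t (q t + h) * (u t (q t + h) - u t (q t))) - (- Qk (sq t) (q t + 0) - ux t (q t + 0) * (u t (q t + 0) - u t (q t))))).
  - apply (is_derive_ext (fun s => / h * (u (Rmax 0 s) (q s + h) - u (Rmax 0 s) (q s + 0)))).
    + intros s. unfold dquot. rewrite Rplus_0_r. toR. field. lra.
    + apply (is_derive_scal (fun s => u (Rmax 0 s) (q s + h) - u (Rmax 0 s) (q s + 0)) t (/ h)).
      apply (is_derive_minus (fun s => u (Rmax 0 s) (q s + h)) (fun s => u (Rmax 0 s) (q s + 0))); assumption.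
  - rewrite <- E2. unfold dquot. rewrite Rmax_right, Rplus_0_r by lra.
    replace (Pk (sq t) y1 - sq t y1) with ((Qk (sq t) (q t + h) - Qk (sq t) (q t)) / h) by (rewrite E1; field; lra).
    field. lra.
Qed.

(* No second space derivative of u exists: the difference quotients of u along q
   solve an approximate Riccati equation, and h tends to 0. *)
Lemma slope_derive t : 0 < t -> is_derive (fun s => ux (Rmax 0 s) (q s)) t (- ux t (q t) ^ 2 - (Pk (sq t) (q t) - sq t (q t))).
Proof.
  intros Ht. apply is_derive_eps. intros eps He.
  set (g := ux t (q t)). set (F := fun t y => Pk (sq t) y - sq t y).
  (* The errors in P and [sq] cost e / 2 each, and the product of slopes costs at most e + 2 |g| e;
     the total is e (2 |g| + 2) <= eps. *)
  set (e := Rmin 1 (eps / (2 * Rabs g + 2))).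
  assert (He0 : 0 < eps / (2 * Rabs g + 2)) by (apply Rdiv_lt_0_compat; [lra|]; pose proof (Rabs_pos g); lra).
  assert (He1 : 0 < e) by (apply Rmin_pos; lra).
  destruct (unif_joint ux (cl_ux_unif _ _ _ _ C) (cl_ux_cont _ _ _ _ C) t (q t) e ltac:(lra) He1) as [d1 [Hd1 J1]].
  destruct (unif_joint _ (proj1 PQ_unif) Pk_sq_cont t (q t) (e / 2) ltac:(lra) ltac:(lra)) as [d2 [Hd2 J2]].
  destruct (unif_joint sq sq_unif sq_cont t (q t) (e / 2) ltac:(lra) ltac:(lra)) as [d3 [Hd3 J3]].
  set (d := Rmin d1 (Rmin d2 d3)).
  assert (0 < d /\ d <= d1 /\ d <= d2 /\ d <= d3) as (Hd & L1 & L2 & L3).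
  { split; [repeat apply Rmin_pos; lra|]. unfold d. pose proof (Rmin_l d1 (Rmin d2 d3)). pose proof (Rmin_r d1 (Rmin d2 d3)).
    pose proof (Rmin_l d2 d3). pose proof (Rmin_r d2 d3). lra. }
  (* Half of [d] is spent on the motion of [q], the other half on the step [h]. *)
  destruct (proj1 (cont_eps q t) (q_cont t) (d / 2) ltac:(lra)) as [dq [Hdq Jq]].
  set (r := Rmin dq (Rmin d t)).
  assert (0 < r /\ r <= dq /\ r <= d /\ r <= t) as (Hr & R1 & R2 & R3).
  { split; [repeat apply Rmin_pos; lra|]. unfold r. pose proof (Rmin_l dq (Rmin d t)). pose proof (Rmin_r dq (Rmin d t)).
    pose proof (Rmin_l d t). pose proof (Rmin_r d t). lra. }
  exists r. split; [exact Hr|]. intros s Hs.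
  assert (Hs' : 0 < s) by (apply Rabs_def2 in Hs; lra).
  set (G := - g ^ 2 - (Pk (sq t) (q t) - sq t (q t))).
  assert (Hh : forall h, 0 < h < d / 2 -> Rabs (dquot h s - dquot h t - (s - t) * G) <= eps * Rabs (s - t)).
  { intros h Hh.
    (* The mean value theorem in time at fixed [h]: the resulting bound is the same for all small
       [h]. *)
    destruct (MVT_gen (dquot h) t s (fun k => Derive (dquot h) k)) as [k [Hk E]].
    - intros k Hk. assert (0 < k) by (unfold Rmin in Hk; destruct (Rle_dec t s); lra).
      destruct (dquot_derive h k ltac:(lra) ltac:(lra)) as (y1 & y2 & _ & _ & D). apply Derive_correct. eexists; exact D.
    - intros k Hk. assert (0 < k) by (unfold Rmin in Hk; destruct (Rle_dec t s); lra).
      destruct (dquot_derive h k ltac:(lra) ltac:(lra)) as (y1 & y2 & _ & _ & D). apply continuity_pt_filterlim. exact (cont_derive _ _ _ D).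
    - assert (Hkt : 0 < k /\ Rabs (k - t) < r).
      { apply Rabs_def2 in Hs. unfold Rmin, Rmax in Hk. destruct (Rle_dec t s); (split; [lra | apply Rabs_def1; lra]). }
      destruct Hkt as [Hk0 Hkt].
      destruct (dquot_derive h k ltac:(lra) Hk0) as (y1 & y2 & Hy1 & Hy2 & D). rewrite (is_derive_unique _ _ _ D) in E.
      rewrite E. specialize (Jq k ltac:(lra)). apply Rabs_def2 in Jq.
      assert (A1 : Rabs (ux k (q k + h) - g) < e) by (apply J1; [lra | lra | apply Rabs_def1; lra]).
      assert (A2 : Rabs (ux k y2 - g) < e) by (apply J1; [lra | lra | apply Rabs_def1; lra]).
      assert (A3 : Rabs (Pk (sq k) y1 - Pk (sq t) (q t)) < e / 2) by (apply (J2 k y1); [lra | lra | apply Rabs_def1; lra]).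
      assert (A4 : Rabs (sq k y1 - sq t (q t)) < e / 2) by (apply J3; [lra | lra | apply Rabs_def1; lra]).
      set (X := ux k (q k + h)) in *. set (Y := ux k y2) in *.
      replace ((- (Pk (sq k) y1 - sq k y1) - X * Y) * (s - t) - (s - t) * G) with
        ((- (Pk (sq k) y1 - Pk (sq t) (q t)) + (sq k y1 - sq t (q t)) - ((X - g) * (Y - g) + g * (X - g) + g * (Y - g))) * (s - t)) by (unfold G; ring).
      rewrite Rabs_mult. apply Rmult_le_compat_r; [apply Rabs_pos|].
      assert (B1 : Rabs ((X - g) * (Y - g) + g * (X - g) + g * (Y - g)) <= e * 1 + Rabs g * e + Rabs g * e).
      { assert (e <= 1) by apply Rmin_l.
        eapply Rle_trans; [apply Rabs_triang|]. eapply Rle_trans; [apply Rplus_le_compat_r, Rabs_triang|]. rewrite !Rabs_mult.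
        pose proof (Rabs_pos g). pose proof (Rabs_pos (X - g)). pose proof (Rabs_pos (Y - g)).
        repeat apply Rplus_le_compat; apply Rmult_le_compat; lra. }
      assert (e * (2 * Rabs g + 2) <= eps).
      { apply Rle_trans with (eps / (2 * Rabs g + 2) * (2 * Rabs g + 2)).
        - apply Rmult_le_compat_r; [pose proof (Rabs_pos g); lra | apply Rmin_r].
        - right. field. pose proof (Rabs_pos g). lra. }
      apply Rabs_le_between in B1. apply Rabs_def2 in A3, A4. apply Rabs_le. lra. }
  (* Now h tends to 0 at the fixed times s and t: each quotient is within eta / 2 of the slope, and
     [eta] is arbitrary. *)
  rewrite !Rmax_right by lra. fold g. apply Rle_eps. intros eta Heta.
  assert (L : forall k, 0 <= k -> exists dk, 0 < dk /\ forall h, 0 < h < dk -> Rabs (dquot h k - ux k (q k)) <= eta / 2).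
  { intros k Hk. destruct (proj1 (cont_eps _ (q k)) (cl_ux_cont _ _ _ _ C k Hk (q k)) (eta / 2) ltac:(lra)) as [dk [Hdk Jk]].
    exists dk. split; [exact Hdk|]. intros h Hh'. destruct (dquot_mean h k ltac:(lra) Hk) as [y [Hy ->]].
    left. apply Jk. apply Rabs_def1; lra. }
  destruct (L s ltac:(lra)) as [ds [Hds Ls]]. destruct (L t ltac:(lra)) as [dt [Hdt Lt]].
  set (h := Rmin (d / 4) (Rmin (ds / 2) (dt / 2))).
  assert (0 < h /\ h <= d / 4 /\ h <= ds / 2 /\ h <= dt / 2) as (h0 & h1 & h2 & h3).
  { split; [repeat apply Rmin_pos; lra|]. unfold h. pose proof (Rmin_l (d/4) (Rmin (ds/2) (dt/2))). pose proof (Rmin_r (d/4) (Rmin (ds/2) (dt/2))).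
    pose proof (Rmin_l (ds/2) (dt/2)). pose proof (Rmin_r (ds/2) (dt/2)). lra. }
  specialize (Hh h ltac:(lra)). specialize (Ls h ltac:(lra)). specialize (Lt h ltac:(lra)). fold g in Lt.
  apply Rabs_le_between in Hh, Ls, Lt. apply Rabs_le. lra.
Qed.
End Characteristic.

Lemma classical_vanish : (exists z, u 0 z = 0) -> forall x, u 0 x = 0.
Proof.
  (* The point [y0] where u is not 0 supplies the strict positivity of P + c Q at time 0. *)
  intros [z Hz] y0. destruct (Req_dec (u 0 y0) 0) as [|Hne]; [assumption|exfalso].
  assert (H0 : 0 <= 0) by lra.
  destruct (periodic_zero_nonincreasing (u 0) (ux 0) z (cl_per _ _ _ _ C 0 H0) (cl_ux _ _ _ _ C 0 H0) Hz) as [x0 [Hx0 Hx0']].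
  assert (Cu : forall q, (forall t, continuous q t) -> forall t, continuous (fun t => u (Rmax 0 t) (q t)) t).
  { intros q Hq t. apply (unif_along u (cl_unif _ _ _ _ C) cl_cont q Hq). }
  destruct (global_flow (fun t x => u (Rmax 0 t) x - kappa) x0) as (q & Hq0 & Hqc & Hqd).
  - intros q Hq t. pose proof (Cu q Hq) as c. apply cont_minus; [apply c | cont].
  - intros T HT. destruct (unif_bounded ux (cl_ux_unif _ _ _ _ C) (cl_ux_cont _ _ _ _ C) cl_ux_per T HT) as [L [HL HL']].
    exists L. split; [exact HL|]. intros t x y Ht. rewrite Rmax_right by lra.
    replace (u t x - kappa - (u t y - kappa)) with (u t x - u t y) by ring.
    apply (bounded_variation (u t) (ux t) L y x). intros w _. split; [apply (cl_ux _ _ _ _ C); lra | apply HL'; lra].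
  - intros T HT. destruct (unif_bounded u (cl_unif _ _ _ _ C) cl_cont (cl_per _ _ _ _ C) T HT) as [M [HM HM']].
    exists (M + Rabs kappa). pose proof (Rabs_pos kappa). split; [lra|]. intros t x Ht. rewrite Rmax_right by lra.
    eapply Rle_trans; [apply Rabs_triang|]. rewrite Rabs_Ropp. specialize (HM' t x Ht). lra.
  - apply (riccati_blowup (fun t => u (Rmax 0 t) (q t)) (fun t => ux (Rmax 0 t) (q t))
      (fun t => Pk (sq (Rmax 0 t)) (q t)) (fun t => Qk (sq (Rmax 0 t)) (q t))).
    + now apply Cu.
    + exact (unif_along ux (cl_ux_unif _ _ _ _ C) (cl_ux_cont _ _ _ _ C) q Hqc).
    + exact (unif_along _ (proj1 PQ_unif) Pk_sq_cont q Hqc).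
    + exact (unif_along _ (proj2 PQ_unif) Qk_sq_cont q Hqc).
    + intros t Ht. pose proof (along_derive q Hqd 0 t Ht) as D.
      apply (is_derive_ext _ (fun t => u (Rmax 0 t) (q t))) in D; [|intros; toR; now rewrite Rplus_0_r].
      rewrite Rplus_0_r, Rminus_diag, Rmult_0_r, Rminus_0_r in D. now rewrite (Rmax_right 0 t) by lra.
    + intros t Ht. pose proof (slope_derive q Hqc Hqd t Ht) as D.
      rewrite (Rmax_right 0 t) by lra.
      replace (- ux t (q t) ^ 2 + 3 / 2 * u t (q t) ^ 2 - Pk (sq t) (q t)) with (- ux t (q t) ^ 2 - (Pk (sq t) (q t) - sq t (q t))); [exact D|].
      unfold sq at 2. ring.
    + now rewrite Rmax_left, Hq0 by lra.
    + now rewrite Rmax_left, Hq0 by lra.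
    + intros c t Hc Ht. apply Pk_comb_nonneg; [apply sq_cont, Rmax_l | destruct Hc; lra | apply sq_nonneg].
    + intros c Hc. rewrite Rmax_left by lra. apply Pk_comb_pos with y0; [now apply sq_per | now apply sq_cont | destruct Hc; lra | apply sq_nonneg |].
      unfold sq. assert (0 < u 0 y0 ^ 2) by (apply pow2_gt_0; exact Hne). lra.
Qed.
End Classical.

Theorem classical_liouville kappa u ux ut : classical kappa u ux ut -> (exists t0 x0, 0 <= t0 /\ u t0 x0 = 0) ->
  forall t x, 0 <= t -> u t x = 0.
Proof.
  intros C (t0 & x0 & Ht0 & H0).
  assert (V : forall t, 0 <= t -> (exists z, u t z = 0) -> forall x, u t x = 0).
  (* Writing t as t + 0 exhibits [u t] as the initial state of the time-shifted solution. *)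
  { intros t Ht. rewrite <- (Rplus_0_r t). exact (classical_vanish _ _ _ _ (classical_shift _ _ _ _ t Ht C)). }
  assert (M0 : RInt (u t0) 0 1 = 0).
  { rewrite (RInt_ext _ (fun _ => 0)).
    - rewrite RInt_const. apply Rmult_0_r.
    - intros x _. apply V; [exact Ht0 | now exists x0]. }
  intros t x Ht. apply V; [exact Ht|]. apply mean_zero_vanishes; [now apply (cl_cont _ _ _ _ C)|].
  rewrite (mean_conserved _ _ _ _ C t Ht), <- (mean_conserved _ _ _ _ C t0 Ht0). exact M0.
Qed.

(** * From Sobolev to classical solutions *)

Lemma within_eps (phi : R -> R) (D : R -> Prop) t : filterlim phi (within D (locally t)) (locally 0) ->
  forall eps, 0 < eps -> exists d, 0 < d /\ forall s, D s -> Rabs (s - t) < d -> Rabs (phi s) < eps.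
Proof.
  intros H eps He. destruct (proj1 (filterlim_locally phi 0) H (mkposreal eps He)) as [d Hd].
  exists d. split; [apply cond_pos|]. intros s Hs A. specialize (Hd s A Hs).
  change (Rabs (phi s - 0) < eps) in Hd. now rewrite Rminus_0_r in Hd.
Qed.

Lemma Hs_minus s f g : Hs s f -> Hs s g -> Hs s (fun x => f x - g x).
Proof.
  intros Hf Hg. replace (fun x => f x - g x) with (fun x => 1 * f x + -1 * g x); [now apply Hs_linear|].
  apply functional_extensionality. intros x. ring.
Qed.

Lemma Hs_div s f a : Hs s f -> Hs s (fun x => f x / a).
Proof.
  intros Hf. replace (fun x => f x / a) with (fun x => / a * f x + 0 * f x); [now apply Hs_linear|].
  apply functional_extensionality. intros x. unfold Rdiv. ring.
Qed.

Lemma C0_Hs_near s v t : C0_Hs s v -> 0 <= t -> forall eps, 0 < eps -> exists d, 0 < d /\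
  forall t', 0 <= t' -> Rabs (t' - t) < d -> Hs s (fun x => v t' x - v t x) /\ Hs_norm s (fun x => v t' x - v t x) < eps.
Proof.
  intros H Ht eps He. destruct (H t Ht) as [Ht1 Ht2]. destruct (within_eps _ _ _ Ht2 eps He) as [d [Hd Hd']].
  exists d. split; [exact Hd|]. intros t' Ht' A. split.
  - apply Hs_minus; [apply H; exact Ht' | exact Ht1].
  - eapply Rle_lt_trans; [apply Rle_abs | now apply Hd'].
Qed.

(** The space regularity uses s > 3/2 through the C^1 embedding; the time derivative lives in
    H^(s-1), where s - 1 > 1/2 still gives sup-norm control. *)
Lemma DP_classical s kappa v vt : 3 / 2 < s -> C0_Hs s v -> C1_Hs (s - 1) v vt ->
  (forall t x, 0 < t -> vt t x + v t x * Derive (v t) x + Derive (conv p (fun y => 3 / 2 * v t y ^ 2 + 3 * kappa * v t y)) x = 0) ->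
  classical kappa (fun t x => v t x + kappa) (fun t => Derive (v t)) vt.
Proof.
  intros Hs32 H0 (H1 & H2 & H3) Hpde. destruct (sobolev_C1 s Hs32) as [S1 S2].
  assert (Cv : forall t, 0 <= t -> forall x, continuous (v t) x) by (intros t Ht; apply (H0 t Ht)).
  assert (Pv : forall t, 0 <= t -> periodic1 (v t)) by (intros t Ht; apply (H0 t Ht)).
  assert (Dv : forall t, 0 <= t -> forall x, ex_derive (v t) x) by (intros t Ht x; apply (S1 (v t)), (H0 t Ht)).
  split.
  - intros t Ht x. now rewrite Pv.
  - intros t Ht x. rewrite <- (Rplus_0_r (Derive (v t) x)). apply (is_derive_plus (v t) (fun _ => kappa)).
    + now apply Derive_correct, Dv.
    + exact (@is_derive_const R_AbsRing R_NormedModule kappa x).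
  - intros t Ht x. apply (S1 (v t)), (H0 t Ht).
  - intros t Ht eps He. destruct (sobolev_sup s ltac:(lra) eps He) as [d0 [Hd0 E]].
    destruct (C0_Hs_near s v t H0 Ht d0 Hd0) as [d [Hd N]]. exists d. split; [exact Hd|]. intros t' Ht' A x.
    replace (v t' x + kappa - (v t x + kappa)) with (v t' x - v t x) by ring.
    apply (E (fun x => v t' x - v t x)); now apply N.
  - intros t Ht eps He. destruct (S2 eps He) as [d0 [Hd0 E]].
    destruct (C0_Hs_near s v t H0 Ht d0 Hd0) as [d [Hd N]]. exists d. split; [exact Hd|]. intros t' Ht' A x.
    rewrite <- Derive_minus by now apply Dv. apply (E (fun x => v t' x - v t x)); now apply N.
  - intros t Ht eps He. assert (Ht' : 0 <= t) by lra.
    destruct (sobolev_sup (s - 1) ltac:(lra) eps He) as [d0 [Hd0 E]].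
    destruct (within_eps _ _ _ (H3 t Ht') d0 Hd0) as [d [Hd N]]. exists d. split; [exact Hd|]. intros t' Ht2 A x.
    (* The limit defining [vt] leaves out t' = t, where the remainder is 0. *)
    destruct (Req_dec t' t) as [->|Hne].
    + replace (v t x + kappa - (v t x + kappa) - (t - t) * vt t x) with 0 by ring.
      rewrite Rminus_diag, Rabs_R0. lra.
    + replace (v t' x + kappa - (v t x + kappa) - (t' - t) * vt t x) with (((v t' x - v t x) / (t' - t) - vt t x) * (t' - t)) by (field; lra).
      rewrite Rabs_mult. apply Rmult_le_compat_r; [apply Rabs_pos|].
      apply (E (fun x => (v t' x - v t x) / (t' - t) - vt t x)).
      * apply Hs_minus; [|apply H2; exact Ht']. apply (Hs_div _ (fun x => v t' x - v t x)).
        apply Hs_minus; [apply H1; exact Ht2 | apply H1; exact Ht'].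
      * eapply Rle_lt_trans; [apply Rle_abs | apply N; [split; assumption | exact A]].
  - intros t Ht x. assert (Ht' : 0 <= t) by lra. specialize (Cv t Ht'). specialize (Pv t Ht').
    rewrite <- (Hpde t x Ht). replace (v t x + kappa - kappa) with (v t x) by ring. f_equal.
    set (g := fun y => 3 / 2 * v t y ^ 2 + 3 * kappa * v t y).
    assert (Cg : forall y, continuous g y) by (intros; unfold g; cont).
    assert (Pg : periodic1 g) by (intros y; unfold g; now rewrite Pv).
    rewrite (Derive_ext (conv p g) (Pk g)) by (intros; now apply conv_p_Pk).
    rewrite (is_derive_unique _ _ _ (Pk_derive g Pg Cg x)).
    (* Completing the square; the constant is written as a multiple of the function 1 so that
       linearity and [Qk_one] eliminate it. *)
    replace (fun y => 3 / 2 * (v t y + kappa) ^ 2) with (fun y => 1 * g y + 3 / 2 * kappa ^ 2 * 1).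
    + rewrite (Qk_lin g (fun _ => 1)), Qk_one; [ring | exact Cg | intros; apply continuous_const].
    + apply functional_extensionality. intros y. unfold g. field.
Qed.

Theorem theorem1p2 (s kappa : R) (hs : 3 / 2 < s) (v : R -> R -> R)
    (hv : DP_global_solution s kappa v)
    (hvanish : exists t0 x0 : R, 0 <= t0 /\ v t0 x0 = - kappa) :
  forall t x : R, 0 <= t -> v t x = - kappa.
Proof.
  destruct hv as (H0 & vt & H1 & Hpde). destruct hvanish as (t0 & x0 & Ht0 & E).
  intros t x Ht.
  pose proof (classical_liouville _ _ _ _ (DP_classical s kappa v vt hs H0 H1 Hpde)) as L.
  assert (v t x + kappa = 0); [|lra]. apply L; [|exact Ht]. exists t0, x0. split; [exact Ht0 | rewrite E; ring].
Qed.
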